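(* Let $r\in\mathbb N$ and let $L:\mathbb R^+\to[0,\infty)$ be any loss function satisfying all of the following. (1) For any $x_1,x_2\in\mathbb R^+$ with $x_2>x_1$, $L$ is of bounded variation on $[x_1,x_2]$. (2) $L$ has a finite number of discontinuities in $\mathbb R^+$. (3) There exists a real $K<r$ such that $L(x)$ is $\Theta(x^K)$ as $x\to0$, and there exists a real $K'<r$ such that $L(x)$ is $\Theta(x^{K'})$ as $x\to\infty$. (4) There exists $\xi\in\mathbb R^+$ such that $L$ is non-increasing on $(0,\xi)$ and $\int_{\xi}^\infty \frac{L(\xi)-L(x)}{x^{r+1}}\,dx>0$. (5) There exists $\xi'\in\mathbb R^+$ such that $L$ is non-decreasing on $(\xi',\infty)$ and one of these conditions holds: (a) $L(\xi'-)<L(\xi'+)$; or (b) there is $t\in\mathbb N$ such that $L$ is of class $C^t$ on an interval containing $\xi'$, $\frac{d^iL}{dx^i}(\xi')=0$ for $i=1,\dots,t-1$, and $(-1)^{t-1}\frac{d^tL}{dx^t}(\xi')>0$. Let $\Omega^*\in\mathbb R^+$ be any value minimizing $\bar\eta(\Omega)$ over $\Omega\in\mathbb R^+$. Then any non-randomized estimator $\hat p=g(N)$, $g:\{r,r+1,\dots\}\to\mathbb R^+$, with $\lim_{n\to\infty}n\,g(n)=\Omega^*$ minimizes $\limsup_{p\to0}\eta(p)$ among all (possibly randomized) estimators based on inverse binomial sampling.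
   Context: $\mathbb R^+=(0,\infty)$, $\mathbb N=\{1,2,\dots\}$. $h(a-)$, $h(a+)$ denote one-sided limits. $h_1(x)$ is $\Theta(h_2(x))$ as $x\to0$ (resp. $x\to\infty$) if there are $a,m,M\in\mathbb R^+$ with $m h_2(x)\le h_1(x)\le M h_2(x)$ for all $x\le a$ (resp. $x\ge a$). Inverse binomial sampling: for $p\in(0,1)$, $N$ is the number of i.i.d. Bernoulli($p$) trials needed to obtain $r$ successes, so $f(n)=\Pr[N=n]=\binom{n-1}{r-1}p^r(1-p)^{n-r}$ for $n\ge r$. A (possibly randomized) estimator $\hat p$ of $p$ is specified by a family $(\Pi_n)_{n\ge r}$ of distribution functions of positive random variables, not depending on $p$; $\Pi_n$ is the distribution function of $\hat p$ conditioned on $N=n$. Its risk is $\eta(p)=\mathrm E[L(\hat p/p)]=\sum_{n=r}^\infty f(n)\int_0^\infty L(y/p)\,d\Pi_n(y)\in[0,\infty]$. For a non-randomized estimator $\hat p=g(N)$, each $\Pi_n$ is a point mass at $g(n)$, so $\eta(p)=\sum_{n\ge r}f(n)L(g(n)/p)$. For $\Omega\in\mathbb R^+$, $\bar\eta(\Omega)=\int_0^\infty\phi(\nu)L(\Omega/\nu)\,d\nu$ with $\phi(\nu)=\nu^{r-1}e^{-\nu}/(r-1)!$. Under the stated hypotheses $\bar\eta$ attains a minimum over $\Omega\in\mathbb R^+$. *)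

(* Defs.v *)
From HB Require Import structures.
From mathcomp Require Export all_boot all_order all_algebra.
From mathcomp Require Export all_classical all_reals all_analysis measurable_realfun.

Set Implicit Arguments.
Unset Strict Implicit.
Unset Printing Implicit Defensive.

Export Order.TTheory GRing.Theory Num.Theory.
Export numFieldNormedType.Exports.

Local Open Scope classical_set_scope.
Local Open Scope ring_scope.

(* A loss function on (0, +oo) is represented by a function L : R -> R; its
   values on (-oo, 0] are never used. *)

Section loss.
Context {R : realType}.
Implicit Types (L h g : R -> R) (A : set R).

Definition is_Theta_at0 h g := exists a m M : R,
  [/\ 0 < a, 0 < m, 0 < M &
      forall x, 0 < x <= a -> m * g x <= h x <= M * g x].

Definition is_Theta_aty h g := exists a m M : R,
  [/\ 0 < a, 0 < m, 0 < M &
      forall x, a <= x -> m * g x <= h x <= M * g x].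

(* Meaningful for an open set A, on which the total derivatives derive1n i L
   are the derivatives of the restriction of L to A. *)
Definition of_class_C (t : nat) L A :=
  (forall i x, (i < t)%N -> A x -> derivable (derive1n i L) x 1) /\
  (forall x, A x -> {for x, continuous (derive1n t L)}).

(* L(a-) < L(a+); both one-sided limits are required to exist. *)
Definition upward_jump L (a : R) := exists l1 l2 : R,
  [/\ L x @[x --> a^'-] --> l1, L x @[x --> a^'+] --> l2 & l1 < l2].

(* The interval on which L is of class C^t is an open subinterval of (0, +oo)
   containing a, so that the derivatives at a are two-sided. *)
Definition left_increase_order L (a : R) := exists t : nat,
  [/\ (0 < t)%N,
      exists u v : R, 0 <= u /\ u < a < v /\ of_class_C t L `]u, v[,
      forall i, (0 < i < t)%N -> derive1n i L a = 0 &
      0 < (-1) ^+ t.-1 * derive1n t L a].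

End loss.

Section point_mass.
Context {R : realType}.
Variable a : R.

Definition point_mass_df (x : R) : R := (a <= x)%R%:R.

Let point_mass_nd : nondecreasing point_mass_df.
Proof.
move=> x y xy; rewrite /point_mass_df ler_nat.
by case: (leP a x) => // ax; rewrite (le_trans ax xy).
Qed.

Let point_mass_rc : right_continuous point_mass_df.
Proof.
move=> x; rewrite /point_mass_df; apply: cvg_near_cst.
have [ax|xa] := leP a x.
  by near=> y; rewrite (le_trans ax)//.
near=> y; rewrite leNgt (_ : y < a)//; near: y; exact: nbhs_right_lt.
Unshelve. all: end_near. Qed.

HB.instance Definition _ :=
  isCumulative.Build R _ R point_mass_df point_mass_nd point_mass_rc.

Let point_mass_Ny : point_mass_df @ -oo --> (0 : R).
Proof.
apply: cvg_near_cst; near=> x.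
rewrite /point_mass_df leNgt (_ : x < a)//.
by near: x; apply: nbhs_ninfty_lt; rewrite num_real.
Unshelve. all: end_near. Qed.

Let point_mass_y : point_mass_df @ +oo --> (1 : R).
Proof.
apply: cvg_near_cst; near=> x; rewrite /point_mass_df.
suff -> : a <= x by [].
by near: x; apply: nbhs_pinfty_ge; rewrite num_real.
Unshelve. all: end_near. Qed.

HB.instance Definition _ :=
  isCumulativeBounded.Build R 0 1 point_mass_df point_mass_Ny point_mass_y.

End point_mass.

Lemma lebesgue_stieltjes_point_mass (R : realType) (a : R)
    (A : set (measurableTypeR R)) : measurable A ->
  lebesgue_stieltjes_measure (point_mass_df a) A = dirac a A.
Proof.
move=> mA.
apply: (@lebesgue_stieltjes_measure_unique R (point_mass_df a)
  (@dirac _ (measurableTypeR R) a R)) => // I.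
case=> -[x y] /= _ <-.
rewrite /lebesgue_stieltjes_measure /measure_extension/=.
rewrite measurable_mu_extE/=; last exact: is_ocitv.
rewrite diracE.
have [xy|yx] := leP x y.
  rewrite wlength_itv_bnd// /point_mass_df.
  have [ax|xa] := leP a x.
    by rewrite (le_trans ax xy)/= subrr memNset//= in_itv/= ltNge ax.
  rewrite subr0; case: (leP a y) => ay.
    by rewrite mem_set//= in_itv/= xa ay.
  by rewrite memNset//= in_itv/= xa leNgt ay.
rewrite set_itv_ge ?wlength0 ?memNset//.
by rewrite bnd_simp -leNgt ltW.
Qed.

Section estimator.
Context {R : realType}.

(* cond_df n is the distribution function of the estimator given N = n; the
   variable is positive iff its distribution function vanishes at 0. The
   values for n < r are irrelevant. *)
Record estimator (r : nat) := Estimator {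
  cond_df : nat -> cumulativeBounded (0 : R) (1 : R) ;
  cond_df_pos : forall n, (r <= n)%N -> cond_df n 0 = 0 }.

Lemma nonrandomized_pos (r : nat) (g : nat -> R) :
  (forall n, (r <= n)%N -> 0 < g n) ->
  forall n, (r <= n)%N -> (point_mass_df (g n) : R -> R) 0 = 0.
Proof. by move=> g0 n rn; rewrite /point_mass_df leNgt g0. Qed.

Definition nonrandomized (r : nat) (g : nat -> R)
    (g0 : forall n, (r <= n)%N -> 0 < g n) : estimator r :=
  @Estimator r (fun n => point_mass_df (g n)) (nonrandomized_pos g0).

Definition negbin_pmf (r : nat) (p : R) (n : nat) : R :=
  'C(n.-1, r.-1)%:R * p ^+ r * (1 - p) ^+ (n - r).

Definition risk (r : nat) (L : R -> R) (e : estimator r) (p : R) : \bar R :=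
  (\sum_(r <= n <oo) (negbin_pmf r p n)%:E *
     \int[lebesgue_stieltjes_measure (cond_df e n)]_(y in
         (`]0%R, +oo[%classic : set R)) (L (y / p))%:E)%E.

Lemma risk_nonrandomized (r : nat) (L : R -> R) (g : nat -> R)
   (g0 : forall n, (r <= n)%N -> 0 < g n) (p : R) : 0 < p ->
  measurable_fun (`]0%R, +oo[%classic : set R) L ->
  risk L (nonrandomized g0) p =
  (\sum_(r <= n <oo) (negbin_pmf r p n * L (g n / p))%:E)%E.
Proof.
move=> p0 mL; rewrite /risk.
rewrite eseries_cond [RHS]eseries_cond; apply: eq_eseriesr => n rn.
rewrite [RHS]EFinM.
congr (_ * _)%E.
rewrite (@eq_measure_integral _ _ _ _
  (@dirac _ (measurableTypeR R) (g n) R)); last first.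
  by move=> A mA _; exact: lebesgue_stieltjes_point_mass.
rewrite integral_dirac//.
  by rewrite diracE mem_set ?mul1e//= in_itv/= g0//; case/andP: rn.
apply/measurable_EFinP.
apply: (@measurable_comp _ _ _ _ _ _ (`]0%R, +oo[%classic : set R) L) => //.
  move=> _ [y /= + <-]; rewrite !in_itv/= !andbT => y0; exact: divr_gt0.
exact: measurable_funM.
Qed.

Definition asymptotic_risk (r : nat) (L : R -> R) (e : estimator r) : \bar R :=
  limf_esup (risk L e) (0 : R)^'+.

Definition gamma_density (r : nat) (nu : R) : R :=
  nu ^+ r.-1 * expR (- nu) / (r.-1)`!%:R.

Definition eta_bar (r : nat) (L : R -> R) (Omega : R) : \bar R :=
  (\int[lebesgue_measure]_(nu in `]0%R, +oo[)
     (gamma_density r nu * L (Omega / nu))%:E)%E.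

End estimator.
Arguments estimator R r : clear implicits.

(* Main.v *)
(** A weighted average of the risk with weight [1 / p] on [(alpha, p0)] is at
    most [limsup eta + o(1)].  For a fixed number [n] of trials and a fixed
    value [y] of the estimator, the substitution [nu = n p] turns
    [f_p(n) L(y / p) dp / p] into approximately [phi(nu) L(n y / nu) dnu / n],
    whose integral is [eta_bar(n y) / n >= eta_bar(Omega) / n].  The range of
    [n] for which the mass of [phi], truncated to a compact interval, fits into
    [(alpha, p0)] makes [sum 1 / n] equal to [ln (p0 / alpha) + O(1)], so that
    [limsup eta >= eta_bar(Omega)] for every estimator.  The truncation error
    is uniform in the argument of [eta_bar] because [L] is monotone near [0]
    and near infinity.  Conversely, for [n g(n) --> Omega] the risk is the
    integral of a step function of [nu] which converges almost everywhere to
    [phi(nu) L(Omega / nu)], and dominated convergence gives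
    [eta --> eta_bar(Omega)]. *)

Require Import Defs.
From mathcomp Require Import zify ring lra.
Local Open Scope classical_set_scope.
Local Open Scope ring_scope.


(** * Gamma-type integrals *)

(** No lower bound on the risk holds at a single [p]: an estimator tuned to that [p] may do better
    there than the optimum of [eta_bar]. The weight [1 / p] is the scale-invariant one, so after
    [nu = n p] every [n] faces the same density, and only the argument [n y] of [eta_bar] depends on
    the estimator. Since the laws of the estimator for different [n] are unrelated, [n y] may lie
    anywhere in (0, +oo) and may drift to either end as [n] grows. The truncation level must
    therefore be fixed before [n] and [y]. Truncation itself cannot be avoided: the pmf is close to
    [phi (n p)] only while [n p] stays bounded as [n] grows. On a compact range of arguments an
    integrable majorant controls the loss from truncation, but its constant blows up at the ends,
    where a separate argument from monotonicity replaces it. *)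

Section exhaustion.
Context {R : realType}.
Local Notation mu := (@lebesgue_measure R).

(** A compact exhaustion of (0, +oo), symmetric under inversion, so that [Om / nu] stays within a
    factor [k.+1] of [Om]. The shift of the index puts 1 in every member. *)
Definition itv_inv (k : nat) : set R := `[k.+1%:R^-1, k.+1%:R]%classic.

Lemma itv_inv_gt0 k x : itv_inv k x -> 0 < x.
Proof.
by rewrite /itv_inv/= in_itv/= => /andP[+ _]; apply: lt_le_trans;
    rewrite invr_gt0 ltr0Sn.
Qed.

Lemma itv_inv1 k : itv_inv k 1.
Proof. by rewrite /itv_inv/= in_itv/= invf_le1 ?ltr0Sn// ler1n. Qed.

Lemma bigcup_itv_inv : \bigcup_k itv_inv k = `]0, +oo[%classic.
Proof.
apply/seteqP; split => [x [k _ /itv_inv_gt0 x0]|x] /=; rewrite in_itv/= andbT//.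
move=> x0; exists (Num.truncn (Num.max x x^-1)) => //=.
have m0 : 0 < Num.max x x^-1 by rewrite lt_max x0.
have := truncnS_gt (Num.max x x^-1).
rewrite gt_max => /andP[xk ixk]; rewrite /itv_inv/= in_itv/= (ltW xk) andbT.
by rewrite -[leRHS]invrK lef_pV2 ?posrE ?ltr0Sn ?invr_gt0// ltW.
Qed.

Lemma nondecreasing_itv_inv : nondecreasing_seq itv_inv.
Proof.
move=> m n mn; rewrite subsetEset => x; rewrite /itv_inv/= !in_itv/=.
move=> /andP[mx xm]; apply/andP; split.
  by apply: le_trans mx; rewrite lef_pV2 ?posrE ?ltr0Sn// ler_nat.
by apply: (le_trans xm); rewrite ler_nat.
Qed.

Lemma cvg_integral_itv_inv (f : R -> \bar R) :
  measurable_fun (`]0%R, +oo[%classic : set R) f -> (forall x : R, (0 < x)%R ->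
      (0 <= f x)%E) ->
  (\int[mu]_(x in itv_inv k) f x @[k --> \oo] --> \int[mu]_(x in `]0%R, +oo[) f
      x)%E.
Proof.
move=> mf f0; rewrite -bigcup_itv_inv.
apply: ge0_nondecreasing_set_cvg_integral => //.
- exact: nondecreasing_itv_inv.
- by move=> i; exact: measurable_itv.
- move=> i; apply: measurable_funS mf => // x /itv_inv_gt0.
  by rewrite /= in_itv/= andbT.
- by move=> i x /itv_inv_gt0 /f0.
Qed.

End exhaustion.
Arguments itv_inv {R} k.

Section gamma_integrals.
Context {R : realType}.
Implicit Types a c x y : R.
Local Notation mu := (@lebesgue_measure R).

Lemma powR_continuous_gt0 c x : 0 < x -> {for x, continuous (@powR R ^~ c)}.
Proof.
move=> x0; apply: differentiable_continuous; apply/derivable1_diffP.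
by apply: derivable_powR; rewrite in_itv/= x0.
Qed.

(* The integrand is the derivative of [1 - (1 + x `^ a)^-1], which lies in
   [0, 1]. *)
Lemma integral_powR_rational_le1 a : 0 < a ->
  (\int[mu]_(x in `]0%R, +oo[) (a * x `^ (a - 1) / (1 + x `^ a) ^+ 2)%:E
    <= 1)%E.
Proof.
move=> a0; pose F x := - (1 + x `^ a)^-1.
pose f x := a * x `^ (a - 1) / (1 + x `^ a) ^+ 2.
have p1 x : 0 < 1 + x `^ a by rewrite ltr_pwDl// powR_ge0.
have f0 x : 0 <= f x.
  by rewrite /f divr_ge0// ?mulr_ge0 ?exprn_ge0 ?powR_ge0// ltW.
have dF x : 0 < x -> is_derive x 1 F (f x).
  move=> x0.
  have dp := is_derive1_powR a x0.
  have nz : (1 + x `^ a) != 0 by rewrite gt_eqF.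
  have d1 : is_derive x 1 (fun x => 1 + x `^ a) (0 + a * x `^ (a - 1)).
    exact: is_deriveD.
  have dV : is_derive x 1 (fun x => (1 + x `^ a)^-1)
      (- (1 + x `^ a) ^- 2 *: (0 + a * x `^ (a - 1))).
    split; first by apply: derivableV => //; exact: ex_derive.
    by rewrite deriveV// derive_val.
  apply: is_derive_eq.
  by rewrite /GRing.scale/= /f; field.
have cf x : 0 < x -> {for x, continuous f}.
  move=> x0; apply: cvgM.
    by apply: cvgM; [exact: cvg_cst|exact: powR_continuous_gt0].
  apply: cvgV; first by rewrite expf_neq0// gt_eqF.
  apply: (@cvg_comp _ _ _ (fun x => 1 + x `^ a) (fun y => y ^+ 2));
      last exact: exprn_continuous.
  by apply: cvgD; [exact: cvg_cst|exact: powR_continuous_gt0].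
have mf : measurable_fun (`]0%R, +oo[%classic : set R) (EFin \o f).
  apply/measurable_EFinP; apply: open_continuous_measurable_fun => //.
  by move=> x; rewrite inE/= in_itv/= andbT => /cf.
have /cvg_lim <-// := @cvg_integral_itv_inv R (EFin \o f) mf (fun x _ => f0 x).
apply: lime_le.
  apply: cvgP; apply: (@cvg_integral_itv_inv R (EFin \o f) mf) => x _.
  exact: f0.
near=> k; have k2 : 1 < k.+1%:R :> R.
  by rewrite ltr1n ltnS; near: k; exact: nbhs_infty_gt.
have k1 : k.+1%:R^-1 < k.+1%:R :> R.
  by rewrite (@lt_trans _ _ 1)// invf_lt1// ltr0Sn.
have gt0 x : k.+1%:R^-1 <= x -> 0 < x.
  by apply: lt_le_trans; rewrite invr_gt0 ltr0Sn.
rewrite /itv_inv (@continuous_FTC2 _ f F)//; last first.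
- move=> x; rewrite in_itv/= => /andP[/ltW/gt0/dF d _].
  by rewrite derive1E derive_val.
- have cF x : 0 < x -> {for x, continuous F}.
    move=> x0; apply: differentiable_continuous; apply/derivable1_diffP.
    by have [] := dF _ x0.
  split.
  + by move=> x; rewrite in_itv/= => /andP[/ltW/gt0/dF[]].
  + by apply: cvg_at_right_filter; apply: cF; exact: gt0.
  + by apply: cvg_at_left_filter; apply: cF; rewrite ltr0Sn.
- apply: continuous_in_subspaceT => x; rewrite inE/= in_itv/= => /andP[/gt0/cf//].
rewrite -EFinB lee_fin /F opprK.
rewrite -[leRHS]add0r lerD// ?oppr_le0 ?invr_ge0 ?(ltW (p1 _))//.
by rewrite invf_le1// lerDl powR_ge0.
Unshelve. all: end_near. Qed.

Lemma powR_le1DX c x (n : nat) : 0 <= x -> 0 <= c -> c <= n%:R ->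
  x `^ c <= 1 + x ^+ n.
Proof.
move=> x0 c0 cn; have [x1|x1] := leP x 1.
  rewrite (@le_trans _ _ 1) ?lerDl ?exprn_ge0//.
  by have := @ge0_ler_powR _ _ c0 x 1; rewrite !nnegrE powR1 => ->.
rewrite -powR_mulrn// (le_trans (ler_powR (ltW x1) cn))//.
by rewrite lerDr.
Qed.

Lemma exprXn_le_fact x (n : nat) : 0 <= x -> x ^+ n <= n`!%:R * expR x.
Proof.
move=> x0; case: n => [|n].
  by rewrite expr0 fact0 mul1r -expR0 ler_expR.
have f0 : 0 < n.+1`!%:R :> R by rewrite ltr0n fact_gt0.
rewrite -ler_pdivrMl// [leLHS]mulrC; apply: le_trans (expR_ge1Dxn n x0).
by rewrite lerDr.
Qed.

Lemma measurable_powR_expR c :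
  measurable_fun setT (fun x => x `^ c * expR (- x)).
Proof.
apply: measurable_funM; first exact: measurable_powR.
by apply: measurableT_comp => //; exact: measurable_funN.
Qed.

(** The rational function integrated above, taken with [a = c + 1], behaves like [x ^ c] at 0; at
    infinity the exponential absorbs its denominator. A multiple of it is therefore a majorant at
    both ends. *)
Lemma integrable_powR_expR c : -1 < c ->
  mu.-integrable (`]0%R, +oo[%classic : set R) (fun x => (x `^ c * expR (- x))%:E).
Proof.
move=> c1; set a := c + 1; have a0 : 0 < a by rewrite /a; lra.
pose n := (Num.truncn a).+1; have an : a <= n%:R by exact/ltW/truncnS_gt.
pose f x := a * x `^ (a - 1) / (1 + x `^ a) ^+ 2.
(* From [1 + x ^ a <= 2 + x ^ n] and [(x / 2) ^ n <= n! e^(x/2)] one gets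
   [1 + x ^ a <= (2 + n! 2 ^ n) e^(x/2)]; squaring cancels [e^(-x)], and the division by [a] offsets
   the factor [a] in [f]. *)
pose M : R := (2 + n`!%:R * 2 ^+ n) ^+ 2 / a.
have M0 : 0 <= M by rewrite /M divr_ge0// ?sqr_ge0// ltW.
have p1 x : 0 < 1 + x `^ a by rewrite ltr_pwDl// powR_ge0.
have f0 x : 0 <= f x.
  by rewrite /f divr_ge0// ?mulr_ge0 ?exprn_ge0 ?powR_ge0// ltW.
have mf : measurable_fun (`]0%R, +oo[%classic : set R) (EFin \o f).
  apply/measurable_EFinP; apply: open_continuous_measurable_fun => //.
  move=> x; rewrite inE/= in_itv/= andbT => x0; apply: cvgM.
    by apply: cvgM; [exact: cvg_cst|exact: powR_continuous_gt0].
  apply: cvgV; first by rewrite expf_neq0// gt_eqF.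
  apply: (@cvg_comp _ _ _ (fun x => 1 + x `^ a) (fun y => y ^+ 2));
      last exact: exprn_continuous.
  by apply: cvgD; [exact: cvg_cst|exact: powR_continuous_gt0].
have intf : mu.-integrable (`]0%R, +oo[%classic : set R) (EFin \o f).
  apply/integrableP; split => //.
  rewrite (_ : integral _ _ _ = \int[mu]_(x in `]0%R, +oo[) (f x)%:E)%E.
    apply: (@le_lt_trans _ _ 1%E); last exact: ltry.
    exact: integral_powR_rational_le1.
  by apply: eq_integral => x _; rewrite gee0_abs ?lee_fin.
apply: (@le_integrable _ _ R mu (`]0%R, +oo[%classic : set R) _
  (fun x => (x `^ c * expR (- x))%:E) (fun x => (M * f x)%:E)) => //.
- apply/measurable_EFinP; apply: measurable_funTS; exact: measurable_powR_expR.
- move=> x; rewrite /= in_itv/= andbT => x0.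
  rewrite lee_fin (ger0_norm (mulr_ge0 M0 (f0 x))).
  rewrite ger0_norm ?mulr_ge0 ?powR_ge0 ?expR_ge0//.
  rewrite /f /M (_ : a - 1 = c); last by rewrite /a addrK.
  have -> : (2 + n`!%:R * 2 ^+ n) ^+ 2 / a * (a * x `^ c / (1 + x `^ a) ^+ 2) =
    x `^ c * ((2 + n`!%:R * 2 ^+ n) / (1 + x `^ a)) ^+ 2.
    by field; rewrite !gt_eqF.
  rewrite ler_wpM2l ?powR_ge0// [in leLHS](splitr x) opprD expRD -expr2.
  rewrite ler_sqr ?nnegrE ?expR_ge0 ?divr_ge0 ?addr_ge0 ?powR_ge0//.
  rewrite ler_pdivlMr// expRN ler_pdivrMl ?expR_gt0//.
  have e1 : 1 <= expR (x / 2) by rewrite -expR0 ler_expR divr_ge0// ltW.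
  have h := powR_le1DX _ _ _ (ltW x0) (ltW a0) an.
  have := @exprXn_le_fact (x / 2) n; rewrite divr_ge0 ?(ltW x0)// => /(_ isT).
  rewrite exprMn exprVn ler_pdivrMr ?exprn_gt0// => h'.
  nra.
- exact: (@integrableZl _ _ R mu _ (measurable_itv `]0%R, +oo[) M _ intf).
Qed.

End gamma_integrals.


(** * Growth bound and measurability of the loss *)

Section loss_growth.
Context {R : realType}.
Implicit Types (L : R -> R) (x : R).

Lemma bounded_variation_ubound (a b : R) L : a <= b -> bounded_variation a b L ->
  exists M, forall x, a <= x <= b -> L x <= M.
Proof.
move=> ab /(bounded_variationP _ ab) bv;
    exists (L a + fine (total_variation a b L)).
move=> x /andP[ax xb].
have h := total_variation_ge L ax; have h2 := total_variation_ge0 L xb.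
have bvD := total_variationD L ax xb.
have : ((`|L x - L a|)%:E <= total_variation a b L)%E.
  by rewrite bvD (le_trans h)// leeDl.
rewrite -(fineK bv) lee_fin => h3.
by rewrite -lerBlDl (le_trans _ h3)// ler_norm.
Qed.

Lemma ge1_powR_sum (s k x : R) : 0 <= s -> 0 <= k -> 0 < x ->
  1 <= x `^ (- s) + x `^ k.
Proof.
move=> s0 k0 x0; have [x1|x1] := leP x 1.
  rewrite (@le_trans _ _ (x `^ (- s))) ?lerDl ?powR_ge0//.
  rewrite -[leLHS](powRr0 x); apply: ger_powR; rewrite ?x0//; lra.
rewrite (@le_trans _ _ (x `^ k)) ?lerDr ?powR_ge0//.
by rewrite -[leLHS](powRr0 x); apply: ler_powR => //; exact: ltW.
Qed.

(** The hypotheses at the two ends and on compact intervals merge into one majorant on (0, +oo). The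
    exponent [s] may be any nonnegative number, since [L (Om / nu)] then contributes [nu ^ s], which
    the exponential in [phi] absorbs; [k] must stay below [r] for [nu ^ (r - 1 - k)] to be
    integrable at 0. *)
Lemma loss_growth L (r : nat) : (0 < r)%N ->
  (forall x1 x2, 0 < x1 -> x1 < x2 -> bounded_variation x1 x2 L) ->
  (exists2 K : R, K < r%:R & is_Theta_at0 L (fun x => x `^ K)) ->
  (exists2 K : R, K < r%:R & is_Theta_aty L (fun x => x `^ K)) ->
  exists C s k : R, [/\ 0 <= C, 0 <= s, 0 <= k < r%:R &
    forall x, 0 < x -> L x <= C * (x `^ (- s) + x `^ k)].
Proof.
move=> r0 bv [K Kr [a [m [M [a0 m0 M0 LK]]]]] [K' K'r [a' [m' [M' [a'0 m'0 M'0
    LK']]]]].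
(* With [al <= 1 <= be], replacing [K] by [- s <= K] on the left and [K'] by [k >= K'] on the right
   only increases the powers. *)
pose al := Num.min a 1; pose be := Num.max (Num.max a' 1) (al + 1).
have al0 : 0 < al by rewrite lt_min a0 ltr01.
have albe : al < be by rewrite !lt_max ltrDl ltr01 !orbT.
have [B LB] := bounded_variation_ubound _ _ _ (ltW albe) (bv _ _ al0 albe).
exists (M + M' + `|B|), (Num.max (- K) 0), (Num.max K' 0); split.
- by rewrite !addr_ge0// ltW.
- by rewrite le_max lexx orbT.
- by rewrite le_max lexx orbT/= gt_max K'r ltr0n.
move=> x x0; set s := Num.max _ _; set k := Num.max _ _.
have s0 : 0 <= s by rewrite le_max lexx orbT.
have k0 : 0 <= k by rewrite le_max lexx orbT.
have p1 := powR_ge0 x (- s); have p2 := powR_ge0 x k.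
have B0 := normr_ge0 B; have sk := ge1_powR_sum _ _ _ s0 k0 x0.
have [xal|alx] := leP x al.
  move: xal; rewrite le_min => /andP[xa x1].
  have := LK x; rewrite x0 xa => /(_ isT)/andP[_ h].
  have : x `^ K <= x `^ (- s).
    by apply: ger_powR; rewrite ?x0// lerNl le_max lexx.
  by nra.
have [bex|xbe] := leP be x.
  move: bex; rewrite !ge_max => /andP[/andP[a'x x1] _].
  have /andP[_ h] := LK' x a'x.
  have : x `^ K' <= x `^ k by apply: ler_powR => //; rewrite le_max lexx.
  by nra.
have := LB x; rewrite (ltW alx) (ltW xbe) => /(_ isT) h.
have := ler_norm B; nra.
Qed.

Lemma measurable_loss L : finite_set [set x : R | 0 < x /\ ~ {for x, continuous
    L}] ->
  measurable_fun (`]0%R, +oo[%classic : set R) L.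
Proof.
move=> fS; set S := [set x | _] in fS.
have cS : closed S.
  exact: (@accessible_finite_set_closed R).1 (hausdorff_accessible (@Rhausdorff
      R)) S fS.
have mS : measurable (S : set R) by exact: closed_measurable.
have -> : (`]0%R, +oo[%classic : set R) = (`]0, +oo[ `\` S) `|` S.
  by rewrite setUC setDUK// => x [x0 _]; rewrite /= in_itv/= x0.
apply/measurable_funU => //; first exact: measurableD.
split.
  apply: open_continuous_measurable_fun.
    by rewrite setDE; apply: openI; [exact: interval_open|exact: closed_openC].
  move=> x; rewrite inE/= in_itv/= andbT => -[x0 /not_andP[//|]].
  by move/contrapT.
move=> _ Y mY; apply: countable_measurable => //.
exact/finite_set_countable/(sub_finite_set (@subIsetl _ _ _) fS).
Qed.
End loss_growth.


(** * Uniform truncation of [eta_bar] *)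

Section gamma_weight.
Context {R : realType}.
Variable r : nat.
Hypothesis r0 : (0 < r)%N.
Implicit Types (L : R -> R) (x nu s k : R).
Local Notation mu := (@lebesgue_measure R).
Local Notation Rpos := (`]0%R, +oo[%classic : set R).
Local Notation phi := (@gamma_density R r).

Lemma fact_pos (n : nat) : 0 < n`!%:R :> R.
Proof. by rewrite ltr0n fact_gt0. Qed.

Lemma gamma_density_gt0 nu : 0 < nu -> 0 < phi nu.
Proof.
by move=> nu0; rewrite /gamma_density divr_gt0 ?fact_pos// mulr_gt0 ?exprn_gt0
    ?expR_gt0.
Qed.

Lemma gamma_density_ge0 nu : 0 < nu -> 0 <= phi nu.
Proof. by move=> /gamma_density_gt0/ltW. Qed.

Lemma measurable_gamma_density : measurable_fun setT phi.
Proof.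
apply: measurable_funM => //; apply: measurable_funM.
  exact: exprn_measurable.
by apply: measurableT_comp => //; exact: measurable_funN.
Qed.

(** Up to a constant depending on [Om], this is the majorant of [phi nu * L (Om / nu)] obtained by
    substituting [Om / nu] in the growth bound. *)
Definition gamma_weight s k nu := (nu `^ s + nu `^ (- k)) * phi nu.

Lemma gamma_weight_ge0 s k nu : 0 < nu -> 0 <= gamma_weight s k nu.
Proof.
by move=> nu0; rewrite mulr_ge0 ?addr_ge0 ?powR_ge0 ?gamma_density_ge0.
Qed.

Lemma measurable_gamma_weight s k : measurable_fun setT (gamma_weight s k).
Proof.
apply: measurable_funM; last exact: measurable_gamma_density.
by apply: measurable_funD; exact: measurable_powR.
Qed.

Lemma le_gamma_weight s k nu : 0 <= s -> 0 <= k -> 0 < nu ->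
  phi nu <= gamma_weight s k nu.
Proof.
move=> s0 k0 nu0; rewrite -[leLHS]mul1r ler_wpM2r ?gamma_density_ge0// addrC.
exact: ge1_powR_sum.
Qed.

Lemma integrable_gamma_weight s k : 0 <= s -> k < r%:R ->
  mu.-integrable Rpos (EFin \o gamma_weight s k).
Proof.
move=> s0 kr.
pose c1 : R := s + r.-1%:R; pose c2 : R := r.-1%:R - k.
have rE : r%:R = r.-1%:R + 1 :> R by rewrite natr1 prednK.
have i1 : mu.-integrable Rpos (fun x => (x `^ c1 * expR (- x))%:E).
  by apply: integrable_powR_expR; have : 0 <= r.-1%:R :> R by []; rewrite /c1; lra.
have i2 : mu.-integrable Rpos (fun x => (x `^ c2 * expR (- x))%:E).
  by apply: integrable_powR_expR; rewrite /c2; lra.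
have mR : measurable Rpos by exact: measurable_itv.
have i3 := @integrableD _ _ R mu _ mR _ _ i1 i2.
have i4 := @integrableZl _ _ R mu _ mR (r.-1)`!%:R^-1 _ i3.
apply: eq_integrable i4 => // x; rewrite inE/= in_itv/= andbT => x0.
rewrite -EFinD -EFinM; congr EFin; rewrite /gamma_weight/gamma_density /c1 /c2.
rewrite powRD ?(gt_eqF x0) ?implybT// powRD ?(gt_eqF x0) ?implybT//.
rewrite powR_mulrn ?(ltW x0)//; have := fact_pos r.-1 => f0.
by field; rewrite gt_eqF.
Qed.

Lemma integrable_gamma_density : mu.-integrable Rpos (EFin \o phi).
Proof.
have i := integrable_gamma_weight 0 0 (lexx _); rewrite ltr0n r0 in i.
have {}i := i isT.
apply: (@le_integrable _ _ R mu Rpos _ (EFin \o phi) (EFin \o gamma_weight 0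
    0)) => //.
  by apply/measurable_EFinP; apply: measurable_funTS;
      exact: measurable_gamma_density.
move=> x /=; rewrite in_itv/= andbT => x0.
by rewrite lee_fin !ger0_norm ?gamma_density_ge0 ?gamma_weight_ge0 ?le_gamma_weight.
Qed.

(** On [1, 2] the density is at least [expR (- 2) / (r - 1)!]. Positivity of the mass is what later
    allows division by it. *)
Lemma integral_gamma_density_gt0 : (0 < \int[mu]_(x in Rpos) (phi x)%:E)%E.
Proof.
pose c : R := expR (- 2) / (r.-1)`!%:R.
have c0 : 0 < c by rewrite divr_gt0 ?expR_gt0 ?fact_pos.
apply: (@lt_le_trans _ _ (\int[mu]_(x in `[1%R, 2%R]) c%:E)%E).
  rewrite integral_cst//= lebesgue_measure_itv/= lte_fin ltr1n/= -EFinB -EFinM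
      lte_fin.
  by rewrite mulr_gt0// subr_gt0 ltr1n.
apply: (@le_trans _ _ (\int[mu]_(x in `[1%R, 2%R]) (phi x)%:E)%E).
  apply: ge0_le_integral => //.
  - by move=> x _; rewrite lee_fin ltW.
  - by apply/measurable_EFinP; apply: measurable_funTS;
      exact: measurable_gamma_density.
  - move=> x /=; rewrite in_itv/= => /andP[x1 x2].
    rewrite lee_fin /c /gamma_density ler_pM2r ?invr_gt0 ?fact_pos//.
    rewrite -[leLHS]mul1r ler_pM ?expR_ge0 ?exprn_ege1//.
    by rewrite ler_expR lerN2.
apply: ge0_subset_integral => //.
- by apply/measurable_EFinP; apply: measurable_funTS;
    exact: measurable_gamma_density.
- by move=> x /=; rewrite in_itv/= andbT => x0; rewrite lee_fin gamma_density_ge0.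
- move=> x /=; rewrite !in_itv/= andbT => /andP[x1 _]; exact: lt_le_trans x1.
Qed.

End gamma_weight.

Section tail.
Context {R : realType}.
Local Notation mu := (@lebesgue_measure R).
Local Notation Rpos := (`]0%R, +oo[%classic : set R).

Lemma integral_itv_inv_tail (f : R -> \bar R) k :
  measurable_fun Rpos f -> (forall x : R, (0 < x)%R -> (0 <= f x)%E) ->
  (\int[mu]_(x in Rpos) f x =
   \int[mu]_(x in itv_inv k) f x + \int[mu]_(x in Rpos `\` itv_inv k) f x)%E.
Proof.
move=> mf f0.
have sub : itv_inv k `<=` Rpos.
  by move=> x /itv_inv_gt0; rewrite /= in_itv/= andbT.
have mI : measurable (itv_inv k : set R) by exact: measurable_itv.
rewrite -ge0_integral_setU//.
- by rewrite setDUK.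
- exact: measurableD.
- by rewrite setDUK.
- by rewrite setDUK// => x /=; rewrite in_itv/= andbT => /f0.
- by rewrite disj_set2E setDIK.
Qed.

Lemma integrable_tail_itv_inv (f : R -> R) (d : R) :
  mu.-integrable Rpos (EFin \o f) -> (forall x, 0 < x -> 0 <= f x) -> 0 < d ->
  \forall k \near \oo,
   (\int[mu]_(x in Rpos `\` itv_inv k) (f x)%:E <= d%:E)%E.
Proof.
move=> fi f0 d0.
have mf := measurable_int _ fi.
have f0' (x : R) : 0 < x -> (0 <= (EFin \o f) x)%E by move=> x0; rewrite lee_fin f0.
have fin : (\int[mu]_(x in Rpos) (f x)%:E)%E \is a fin_num.
  exact: (@integrable_fin_num _ _ R mu Rpos (measurable_itv _) _ fi).
have := @cvg_integral_itv_inv R _ mf f0'.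
rewrite -(fineK fin) => /fine_cvgP[_ cv].
have {cv} : \forall k \near \oo, fine (\int[mu]_(x in Rpos) (f x)%:E)%E - d <
    fine (\int[mu]_(x in itv_inv k) (f x)%:E)%E.
  by apply: cvgr_gt cv _ _; rewrite ltrBlDr ltrDl.
apply: filterS => k.
have Ik := integral_itv_inv_tail _ k mf f0'.
have A0 : (0 <= \int[mu]_(x in itv_inv k) (f x)%:E)%E.
  by apply: integral_ge0 => x /itv_inv_gt0/f0'.
have B0 : (0 <= \int[mu]_(x in Rpos `\` itv_inv k) (f x)%:E)%E.
  by apply: integral_ge0 => x [/= + _]; rewrite in_itv/= andbT => /f0'.
move: fin; rewrite Ik.
case: (integral _ _ _) A0 => [a||]//; case: (integral _ _ _) B0 => [b||]//= _ _ _.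
rewrite lee_fin; lra.
Qed.

End tail.


Section eta_bar_truncation.
Context {R : realType}.
Variables (r : nat) (L : R -> R) (C s k : R).
Local Notation mu := (@lebesgue_measure R).
Local Notation Rpos := (`]0%R, +oo[%classic : set R).
Local Notation phi := (@gamma_density R r).
Local Notation W := (@gamma_weight R r s k).
Hypothesis r0 : (0 < r)%N.
Hypothesis L0 : forall x, 0 < x -> 0 <= L x.
Hypothesis mL : measurable_fun Rpos L.
Hypotheses (C0 : 0 <= C) (s0 : 0 <= s) (k0 : 0 <= k) (kr : k < r%:R).
Hypothesis LC : forall x, 0 < x -> L x <= C * (x `^ (- s) + x `^ k).

Definition eta_bar_trunc (n : nat) (Om : R) : \bar R :=
  (\int[mu]_(nu in itv_inv n) (phi nu * L (Om / nu))%:E)%E.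

Lemma measurable_loss_div Om : 0 < Om ->
  measurable_fun Rpos (fun nu => L (Om / nu)).
Proof.
move=> Om0; apply: (@measurable_comp _ _ _ _ _ _ Rpos L) => //.
  move=> _ [nu /= + <-]; rewrite !in_itv/= !andbT => nu0; exact: divr_gt0.
apply: open_continuous_measurable_fun => //.
move=> nu; rewrite inE/= in_itv/= andbT => nu0; apply: cvgM; first exact: cvg_cst.
by apply: cvgV => //; rewrite gt_eqF.
Qed.

Lemma measurable_eta_bar_integrand Om : 0 < Om ->
  measurable_fun Rpos (fun nu => (phi nu * L (Om / nu))%:E).
Proof.
move=> Om0; apply/measurable_EFinP; apply: measurable_funM.
  by apply: measurable_funTS; exact: measurable_gamma_density.
exact: measurable_loss_div.
Qed.

Lemma eta_bar_integrand_ge0 Om nu : 0 < Om -> 0 < nu ->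
  (0 <= (phi nu * L (Om / nu))%:E)%E.
Proof.
by move=> Om0 nu0; rewrite lee_fin mulr_ge0 ?gamma_density_ge0 ?L0 ?divr_gt0.
Qed.

Lemma eta_barE n Om : 0 < Om -> (eta_bar r L Om = eta_bar_trunc n Om +
  \int[mu]_(nu in Rpos `\` itv_inv n) (phi nu * L (Om / nu))%:E)%E.
Proof.
move=> Om0; rewrite /eta_bar (integral_itv_inv_tail _ n)//.
  exact: measurable_eta_bar_integrand.
by move=> x x0; exact: eta_bar_integrand_ge0.
Qed.

Lemma eta_bar_trunc_nd m n Om : 0 < Om -> (m <= n)%N ->
  (eta_bar_trunc m Om <= eta_bar_trunc n Om)%E.
Proof.
move=> Om0 mn; have sub j : (itv_inv j : set R) `<=` Rpos.
  by move=> x /itv_inv_gt0; rewrite /= in_itv/= andbT.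
apply: ge0_subset_integral; [exact: measurable_itv|exact: measurable_itv| | |].
- by apply: (measurable_funS _ (sub n)) => //; exact: measurable_eta_bar_integrand.
- by move=> x /itv_inv_gt0 x0; exact: eta_bar_integrand_ge0.
- by have := @nondecreasing_itv_inv R _ _ mn; rewrite subsetEset.
Qed.

Local Notation tail n := (\int[mu]_(nu in Rpos `\` itv_inv n) (W nu)%:E)%E.

Lemma integral_tail_le n Om B : 0 <= B -> 0 < Om ->
  (forall nu, 0 < nu -> L (Om / nu) <= B * (nu `^ s + nu `^ (- k))) ->
  (\int[mu]_(nu in Rpos `\` itv_inv n) (phi nu * L (Om / nu))%:E <= B%:E * tail
      n)%E.
Proof.
move=> B0 Om0 LB.
have mD : measurable (Rpos `\` itv_inv n) by apply: measurableD;
    exact: measurable_itv.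
have pos (x : R) : (Rpos `\` itv_inv n) x -> 0 < x by move=> [/=];
    rewrite in_itv/= andbT.
rewrite -ge0_integralZl//.
- apply: ge0_le_integral => //.
  + by move=> x /pos x0; exact: eta_bar_integrand_ge0.
  + apply: measurable_funS (measurable_eta_bar_integrand _ Om0) => //.
  + apply/measurable_EFinP; apply: measurable_funM => //.
    by apply: measurable_funTS; exact: measurable_gamma_weight.
  + move=> x /pos x0; rewrite -EFinM lee_fin /gamma_weight mulrA [leRHS]mulrC.
    by rewrite ler_wpM2l ?gamma_density_ge0 ?LB.
- by apply/measurable_EFinP; apply: measurable_funTS;
    exact: measurable_gamma_weight.
- by move=> x /pos x0; rewrite lee_fin gamma_weight_ge0.
Qed.

(** One majorant for all [Om] in a compact interval, which makes the tails uniformly small there;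
    the constant degenerates as [a] tends to 0 or [b] to infinity. *)
Lemma loss_div_le a b Om nu : 0 < a -> a <= Om <= b -> 0 < nu ->
  L (Om / nu) <= C * (a `^ (- s) + b `^ k) * (nu `^ s + nu `^ (- k)).
Proof.
move=> a0 /andP[aO Ob] nu0; have O0 : 0 < Om := lt_le_trans a0 aO.
apply: (le_trans (LC _ (divr_gt0 O0 nu0))); rewrite -mulrA ler_wpM2l//.
rewrite !powRM ?(ltW O0) ?invr_ge0 ?(ltW nu0)//.
rewrite -!powR_inv1 ?(ltW nu0)// -!powRrM mulN1r opprK mulN1r.
have h1 : Om `^ (- s) <= a `^ (- s).
  rewrite !powRN lef_pV2 ?posrE ?powR_gt0//.
  by apply: ge0_ler_powR; rewrite ?nnegrE// ltW.
have h2 : Om `^ k <= b `^ k.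
  by apply: ge0_ler_powR; rewrite ?nnegrE ?(ltW O0)// (le_trans (ltW O0)).
have := powR_ge0 nu s; have := powR_ge0 nu (- k).
have := powR_ge0 Om k; have := powR_ge0 Om (- s); nra.
Qed.

Lemma integrable_eta_bar Om : 0 < Om ->
  mu.-integrable Rpos (fun nu => (phi nu * L (Om / nu))%:E).
Proof.
move=> Om0; pose B := C * (Om `^ (- s) + Om `^ k).
have iW := @integrable_gamma_weight R r r0 s k s0 kr.
apply: (@le_integrable _ _ R mu Rpos _ (fun nu => (phi nu * L (Om / nu))%:E)
  (fun nu => B%:E * (EFin \o W) nu)%E) => //.
- exact: measurable_eta_bar_integrand.
- move=> x /=; rewrite in_itv/= andbT => x0.
  have B0 : 0 <= B by rewrite mulr_ge0 ?addr_ge0 ?powR_ge0.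
  have W0 := gamma_weight_ge0 r s k x x0.
  have phi0 := gamma_density_ge0 r x x0.
  rewrite /= lee_fin (ger0_norm (mulr_ge0 phi0 (L0 _ (divr_gt0 Om0 x0)))).
  rewrite (ger0_norm (mulr_ge0 B0 W0)).
  rewrite /gamma_weight mulrA [leRHS]mulrC ler_wpM2l//.
  by apply: loss_div_le; rewrite ?lexx.
- exact: (@integrableZl _ _ R mu Rpos (measurable_itv _) B _ iW).
Qed.

Variable m : R.
Hypothesis mE : forall Om, 0 < Om -> (m%:E <= eta_bar r L Om)%E.

(* As [Om] goes to an end [F] of (0, +oo), [Om / nu] enters the region [P]
   where [L] is monotone, and [eta_bar r L Om] tends to the limit of [L] along
   [P] times the mass of [phi]; that product is therefore at least [m]. *)
Lemma eta_bar_trunc_end (F : set_system R) (FF : ProperFilter F) (P : set R)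
    (B eps : R) :
  0 <= B -> 0 < eps -> (forall x, P x -> 0 < x) ->
  (forall x n, P x -> \forall Om \near F, forall nu, itv_inv n nu ->
    L x <= L (Om / nu)) ->
  (forall n, \forall Om \near F, forall nu, itv_inv n nu -> P (Om / nu)) ->
  (\forall Om \near F, 0 < Om /\ forall nu, 0 < nu ->
    P (Om / nu) \/ L (Om / nu) <= B * (nu `^ s + nu `^ (- k))) ->
  exists n, \forall Om \near F, (m%:E <= eta_bar_trunc n Om + eps%:E)%E.
Proof.
move=> B0 e0 Pgt0 Pnd PF LB.
have iphi := @integrable_gamma_density R r r0.
have G0 := @integral_gamma_density_gt0 R r.
have Gfin : (\int[mu]_(x in Rpos) (phi x)%:E)%E \is a fin_num.
  exact: (@integrable_fin_num _ _ R mu Rpos (measurable_itv _) _ iphi).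
pose G := fine (\int[mu]_(x in Rpos) (phi x)%:E)%E.
have GE : (\int[mu]_(x in Rpos) (phi x)%:E)%E = G%:E by rewrite fineK.
have {}G0 : 0 < G by rewrite -lte_fin -GE.
(* Otherwise [L <= l] on [P] with [l G = m - eps / 2]. For [Om] far enough towards the end,
   [Om / nu] lies in [P] for [nu] in [itv_inv n], and the tail adds at most [B d <= eps / 4], so
   [eta_bar r L Om < m]. *)
have [x [Px xG]] : exists x, P x /\ m - eps / 2 <= L x * G.
  apply: contrapT => /forallNP noP.
  have {noP} LP x : P x -> L x <= (m - eps / 2) / G.
    move=> Px; have /not_andP[//|/negP] := noP x.
    by rewrite -ltNge ler_pdivlMr// => /ltW.
  set l := (m - eps / 2) / G in LP.
  have lG : l * G = m - eps / 2 by rewrite /l divfK// gt_eqF.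
  have iW := @integrable_gamma_weight R r r0 s k s0 kr.
  pose d := eps / (4 * (B + 1)).
  have d0 : 0 < d by rewrite divr_gt0// mulr_gt0//; lra.
  have [n _ /(_ n (leqnn _)) /= tn] :=
    @integrable_tail_itv_inv R W d iW (gamma_weight_ge0 r s k) d0.
  have [Om [[Om0 OmB] OmP]] := filter_ex (filterI LB (PF n)).
  (* Since 1 lies in [itv_inv n], the point [Om] itself is in [P], where [0 <= L <= l]. *)
  have l0 : 0 <= l.
    by apply: le_trans (LP _ (OmP _ (itv_inv1 n))); apply: L0; rewrite divr1.
  have mD : measurable (Rpos `\` itv_inv n).
    by apply: measurableD; exact: measurable_itv.
  have mI : measurable (itv_inv n : set R) by exact: measurable_itv.
  have pos x : (Rpos `\` itv_inv n) x -> 0 < x by move=> [/=];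
      rewrite in_itv/= andbT.
  have mphi (D : set (g_sigma_algebraType R.-ocitv.-measurable)) :
      measurable_fun D (fun x => (phi x)%:E).
    by apply/measurable_EFinP; apply: measurable_funTS;
        exact: measurable_gamma_density.
  have h1 : (eta_bar_trunc n Om <= l%:E * \int[mu]_(x in itv_inv n) (phi x)%:E)%E.
    rewrite -ge0_integralZl//; last first.
      by move=> x /itv_inv_gt0 x0; rewrite lee_fin gamma_density_ge0.
    rewrite /eta_bar_trunc; apply: ge0_le_integral => //.
    - by move=> x /itv_inv_gt0 x0; exact: eta_bar_integrand_ge0.
    - apply: measurable_funS (measurable_eta_bar_integrand _ Om0) => //.
      by move=> x /itv_inv_gt0; rewrite /= in_itv/= andbT.
    - by apply: measurable_funeM.
    - move=> x Ix; rewrite -EFinM lee_fin [leRHS]mulrC.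
      apply: ler_wpM2l; last exact/LP/OmP.
      exact/gamma_density_ge0/(itv_inv_gt0 _ _ Ix).
  have h2 : (\int[mu]_(nu in Rpos `\` itv_inv n) (phi nu * L (Om / nu))%:E <=
      l%:E * \int[mu]_(x in Rpos `\` itv_inv n) (phi x)%:E + B%:E * tail n)%E.
    rewrite -ge0_integralZl//; last first.
      by move=> x /pos x0; rewrite lee_fin gamma_density_ge0.
    rewrite -ge0_integralZl//; last 2 first.
    - by apply/measurable_EFinP; apply: measurable_funTS;
        exact: measurable_gamma_weight.
    - by move=> x /pos x0; rewrite lee_fin gamma_weight_ge0.
    rewrite -ge0_integralD//; last 4 first.
    - by move=> x /pos x0; rewrite mule_ge0 ?lee_fin ?gamma_density_ge0.
    - by apply: measurable_funeM.
    - by move=> x /pos x0; rewrite mule_ge0 ?lee_fin ?gamma_weight_ge0.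
    - apply/measurable_EFinP; apply: measurable_funM => //.
      by apply: measurable_funTS; exact: measurable_gamma_weight.
    apply: ge0_le_integral => //.
    - by move=> x /pos x0; exact: eta_bar_integrand_ge0.
    - by apply: measurable_funS (measurable_eta_bar_integrand _ Om0) => //.
    - apply/measurable_EFinP; apply: measurable_funD.
        by apply: measurable_funM => //; exact/measurable_EFinP.
      apply: measurable_funM => //.
      by apply: measurable_funTS; exact: measurable_gamma_weight.
    (* By [OmB] the loss is bounded by [l] or by [B] times the sum of powers; both are nonnegative,
       so their sum covers either case. *)
    - move=> x /pos x0; rewrite -!EFinM -EFinD lee_fin /gamma_weight.
      have p0 := gamma_density_ge0 r x x0.
      have q0 : 0 <= x `^ s + x `^ (- k) by rewrite addr_ge0 ?powR_ge0.
      have Bq := mulr_ge0 B0 q0.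
      rewrite [leRHS](_ : _ = phi x * (l + B * (x `^ s + x `^ (- k))));
          last by ring.
      by apply: ler_wpM2l => //; have [/LP h|h] := OmB _ x0; lra.
  have := mE _ Om0; rewrite (eta_barE n)// leNgt => /negP; apply.
  apply: (le_lt_trans (leeD h1 h2)); rewrite addeA -ge0_muleDr; last 2 first.
  - by apply: integral_ge0 => x /itv_inv_gt0 x0; rewrite lee_fin gamma_density_ge0.
  - by apply: integral_ge0 => x /pos x0; rewrite lee_fin gamma_density_ge0.
  rewrite -integral_itv_inv_tail; last 2 first.
  - exact: (mphi Rpos).
  - by move=> x x0; rewrite lee_fin gamma_density_ge0.
  rewrite GE -EFinM lG.
  apply: (@le_lt_trans _ _ ((m - eps / 2)%:E + (B * d)%:E)%E).
    by rewrite leeD2l// EFinM lee_wpmul2l// lee_fin.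
  rewrite -EFinD lte_fin; have : B * d <= eps / 4; last by lra.
  rewrite /d mulrA ler_pdivrMr; last by rewrite mulr_gt0//; lra.
  by rewrite [leRHS](_ : _ = B * eps + eps) ?lerDl ?(ltW e0)//; field.
have Lx0 := L0 _ (Pgt0 _ Px).
(* By monotonicity [L (Om / nu) >= L x] on [itv_inv n], so restricting the mass of [phi] to that
   interval costs at most [L x * d <= eps / 2]. *)
pose d := eps / (2 * (L x + 1)).
have d0 : 0 < d by rewrite divr_gt0// mulr_gt0//; lra.
have [n _ /(_ n (leqnn _)) /= tn] :=
  @integrable_tail_itv_inv R phi d iphi (gamma_density_ge0 r) d0.
exists n; apply: filterS (filterI LB (Pnd x n Px)) => Om [[Om0 _] OmL].
have mI : measurable (itv_inv n : set R) by exact: measurable_itv.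
have mphi (D : set (g_sigma_algebraType R.-ocitv.-measurable)) :
      measurable_fun D (fun x => (phi x)%:E).
  by apply/measurable_EFinP; apply: measurable_funTS;
      exact: measurable_gamma_density.
have h1 : ((L x)%:E * \int[mu]_(x in itv_inv n) (phi x)%:E <= eta_bar_trunc n Om)%E.
  rewrite -ge0_integralZl//; last first.
    by move=> y /itv_inv_gt0 y0; rewrite lee_fin gamma_density_ge0.
  rewrite /eta_bar_trunc; apply: ge0_le_integral => //.
  - by move=> y /itv_inv_gt0 y0; rewrite mule_ge0 ?lee_fin ?gamma_density_ge0.
  - by apply: measurable_funeM.
  - apply: measurable_funS (measurable_eta_bar_integrand _ Om0) => //.
    by move=> y /itv_inv_gt0; rewrite /= in_itv/= andbT.
  - move=> y Iy; rewrite -EFinM lee_fin [leLHS]mulrC.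
    apply: ler_wpM2l; last exact: OmL.
    exact/gamma_density_ge0/(itv_inv_gt0 _ _ Iy).
apply: le_trans (leeD h1 (lexx _)).
move: GE; rewrite (integral_itv_inv_tail _ n); last 2 first.
- exact: (mphi Rpos).
- by move=> y y0; rewrite lee_fin gamma_density_ge0.
have A0 : (0 <= \int[mu]_(x in itv_inv n) (phi x)%:E)%E.
  by apply: integral_ge0 => y /itv_inv_gt0 y0; rewrite lee_fin gamma_density_ge0.
have B0' : (0 <= \int[mu]_(x in Rpos `\` itv_inv n) (phi x)%:E)%E.
  apply: integral_ge0 => y [/= + _]; rewrite in_itv/= andbT => y0.
  by rewrite lee_fin gamma_density_ge0.
move: A0 B0' tn; case: (integral _ _ _) => [a||]//;
    case: (integral _ _ _) => [b||]//=.
rewrite !lee_fin -EFinD => a0 b0 bd -[abG]; rewrite -?EFinM -?EFinD ?lee_fin.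
have : L x * d <= eps / 2.
  rewrite /d mulrA ler_pdivrMr; last by rewrite mulr_gt0//; lra.
  by rewrite [leRHS](_ : _ = L x * eps + eps) ?lerDl ?(ltW e0)//; field.
rewrite -abG mulrDr in xG; have := ler_wpM2l Lx0 bd; lra.
Qed.

Variables xi xi' : R.
Hypothesis xi0 : 0 < xi.
Hypothesis Lxi : {in `]0, xi[ &, nonincreasing_fun L}.
Hypothesis xi'0 : 0 < xi'.
Hypothesis Lxi' : {in `]xi', +oo[ &, nondecreasing_fun L}.

Lemma div_itv_inv n (Om nu : R) : 0 < Om -> itv_inv n nu ->
  Om / n.+1%:R <= Om / nu <= Om * n.+1%:R.
Proof.
move=> Om0 nuI; have nu0 := itv_inv_gt0 _ _ nuI.
move: nuI; rewrite /itv_inv/= in_itv/= => /andP[n1 n2].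
rewrite !ler_pM2l// lef_pV2 ?posrE ?ltr0Sn// n2/=.
by rewrite -[leRHS]invrK lef_pV2 ?posrE ?invr_gt0 ?ltr0Sn.
Qed.

Lemma powR_div (x y c : R) : 0 < x -> 0 < y ->
  (x / y) `^ c = x `^ c * y `^ (- c).
Proof.
move=> x0 y0; rewrite powRM ?invr_ge0 ?(ltW x0) ?(ltW y0)//.
by rewrite -powR_inv1 ?(ltW y0)// -powRrM mulN1r.
Qed.

Lemma eta_bar_trunc0 (eps : R) : 0 < eps ->
  exists n, \forall Om \near (0 : R)^'+, (m%:E <= eta_bar_trunc n Om + eps%:E)%E.
Proof.
(* Outside [P] one has [Om / nu >= xi], hence [(Om / nu) ^ (- s) <= xi ^ (- s)]; for [Om <= 1] also
   [(Om / nu) ^ k <= nu ^ (- k)]. *)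
move=> e0; pose B := C * (xi `^ (- s) + 1).
have B0 : 0 <= B by rewrite mulr_ge0// addr_ge0 ?powR_ge0.
apply: (eta_bar_trunc_end _ _ (`]0%R, xi[%classic) B) => //.
- by move=> x; rewrite /= in_itv/= => /andP[].
- move=> x n; rewrite /= in_itv/= => /andP[x0 xxi].
  near=> Om; move=> nu nuI.
  have Om0 : 0 < Om by near: Om; exact: nbhs_right_gt.
  have /andP[lo hi] := div_itv_inv _ _ _ Om0 nuI.
  have Ox : Om * n.+1%:R < x.
    by rewrite -ltr_pdivlMr ?ltr0Sn//; near: Om; apply: nbhs_right_lt;
        rewrite divr_gt0.
  have Onu : 0 < Om / nu by rewrite divr_gt0 ?(itv_inv_gt0 _ _ nuI).
  apply: Lxi; rewrite ?in_itv/= ?x0 ?xxi ?Onu//=.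
    by rewrite (le_lt_trans hi)// (lt_trans Ox).
  by rewrite (le_trans hi)// ltW.
- move=> n; near=> Om; move=> nu nuI; rewrite /= in_itv/=.
  have Om0 : 0 < Om by near: Om; exact: nbhs_right_gt.
  have /andP[lo hi] := div_itv_inv _ _ _ Om0 nuI.
  rewrite divr_gt0 ?(itv_inv_gt0 _ _ nuI)//= (le_lt_trans hi)//.
  by rewrite -ltr_pdivlMr ?ltr0Sn//; near: Om; apply: nbhs_right_lt;
      rewrite divr_gt0.
- near=> Om.
  have Om0 : 0 < Om by near: Om; exact: nbhs_right_gt.
  have Om1 : Om <= 1 by near: Om; exact: nbhs_right_le.
  split => // nu nu0; rewrite /= in_itv/= divr_gt0//=.
  have [|xO] := ltP (Om / nu) xi; [by left|right].
  apply: (le_trans (LC _ (divr_gt0 Om0 nu0))); rewrite -mulrA ler_wpM2l//.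
  have h1 : (Om / nu) `^ (- s) <= xi `^ (- s).
    rewrite !powRN lef_pV2 ?posrE ?powR_gt0 ?divr_gt0//.
    by apply: ge0_ler_powR; rewrite ?nnegrE ?(ltW xi0)// divr_ge0// ltW.
  have h2 : (Om / nu) `^ k <= nu `^ (- k).
    rewrite powR_div// ler_piMl ?powR_ge0//.
    have := ge0_ler_powR k0; rewrite /Num.nneg => /(_ Om 1).
    by rewrite !nnegrE powR1 => ->//; exact: ltW.
  have h3 := ler_peMr (powR_ge0 xi (- s)) (ge1_powR_sum k s nu k0 s0 nu0).
  rewrite mulrDl mul1r; have := powR_ge0 nu s; lra.
Unshelve. all: end_near. Qed.

Lemma eta_bar_truncy (eps : R) : 0 < eps ->
  exists n, \forall Om \near (pinfty_nbhs R), (m%:E <= eta_bar_trunc n Om +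
      eps%:E)%E.
Proof.
(* The mirror image: outside [P] one has [Om / nu <= xi'], and [Om >= 1] gives
   [(Om / nu) ^ (- s) <= nu ^ s]. *)
move=> e0; pose B := C * (xi' `^ k + 1).
have B0 : 0 <= B by rewrite mulr_ge0// addr_ge0 ?powR_ge0.
apply: (eta_bar_trunc_end _ _ (`]xi', +oo[%classic) B) => //.
- by move=> x; rewrite /= in_itv/= andbT; exact: lt_trans.
- move=> x n; rewrite /= in_itv/= andbT => xxi.
  near=> Om; move=> nu nuI.
  have Om0 : 0 < Om by near: Om; exact: nbhs_pinfty_gt.
  have /andP[lo hi] := div_itv_inv _ _ _ Om0 nuI.
  have Ox : x < Om / n.+1%:R.
    by rewrite ltr_pdivlMr ?ltr0Sn//; near: Om; apply: nbhs_pinfty_gt;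
        rewrite num_real.
  apply: Lxi'; rewrite ?in_itv/= ?xxi//=.
    by rewrite andbT (lt_trans xxi)// (lt_le_trans Ox).
  by rewrite (le_trans _ lo)// ltW.
- move=> n; near=> Om; move=> nu nuI; rewrite /= in_itv/= andbT.
  have Om0 : 0 < Om by near: Om; exact: nbhs_pinfty_gt.
  have /andP[lo hi] := div_itv_inv _ _ _ Om0 nuI.
  rewrite (lt_le_trans _ lo)// ltr_pdivlMr ?ltr0Sn//.
  by near: Om; apply: nbhs_pinfty_gt; rewrite num_real.
- near=> Om.
  have Om1 : 1 <= Om by near: Om; exact: nbhs_pinfty_ge.
  have Om0 : 0 < Om by exact: lt_le_trans Om1.
  split => // nu nu0; rewrite /= in_itv/= andbT.
  have [|xO] := ltP xi' (Om / nu); [by left|right].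
  apply: (le_trans (LC _ (divr_gt0 Om0 nu0))); rewrite -mulrA ler_wpM2l//.
  have h1 : (Om / nu) `^ k <= xi' `^ k.
    by apply: ge0_ler_powR; rewrite ?nnegrE ?(ltW xi'0)// divr_ge0// ltW.
  have h2 : (Om / nu) `^ (- s) <= nu `^ s.
    rewrite powR_div// opprK ler_piMl ?powR_ge0//.
    rewrite powRN invf_le1 ?powR_gt0//.
    by rewrite -[leLHS](powRr0 Om) ler_powR.
  have h3 := ler_peMr (powR_ge0 xi' k) (ge1_powR_sum k s nu k0 s0 nu0).
  rewrite mulrDl mul1r; have := powR_ge0 nu (- k); lra.
Unshelve. all: end_near. Qed.

(** Three ranges of [Om] each supply a level: the two ends by monotonicity of [L], the compact
    middle by one tail of [gamma_weight]. Truncated integrals grow with the level, so the largest of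
    the three serves everywhere. *)
Lemma eta_bar_trunc_uniform (eps : R) : 0 < eps ->
  exists n, forall Om, 0 < Om -> (m%:E <= eta_bar_trunc n Om + eps%:E)%E.
Proof.
move=> e0; have [n1] := eta_bar_trunc0 _ e0; have [n2] := eta_bar_truncy _ e0.
move=> [b [_ Tb]] [a /= a0 Ta].
pose a' := a / 2; pose b' := Num.max a' (b + 1).
have a'0 : 0 < a' by rewrite divr_gt0.
pose B := C * (a' `^ (- s) + b' `^ k).
have B0 : 0 <= B by rewrite mulr_ge0// addr_ge0 ?powR_ge0.
pose d := eps / (B + 1).
have d0 : 0 < d by rewrite divr_gt0//; lra.
have iW := @integrable_gamma_weight R r r0 s k s0 kr.
have [n3 _ /(_ n3 (leqnn _)) /= tn] :=
  @integrable_tail_itv_inv R W d iW (gamma_weight_ge0 r s k) d0.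
pose n := maxn n1 (maxn n2 n3).
have mono j Om : 0 < Om -> (j <= n)%N ->
    (m%:E <= eta_bar_trunc j Om + eps%:E)%E ->
    (m%:E <= eta_bar_trunc n Om + eps%:E)%E.
  move=> O0 jn /le_trans; apply; rewrite leeD2r//.
  exact: eta_bar_trunc_nd.
exists n => Om O0; have [lta|gea] := ltP Om a'.
  apply: (mono n1) => //; first by rewrite leq_maxl.
  apply: Ta => //=; rewrite sub0r normrN gtr0_norm//.
  by rewrite (lt_trans lta)// /a' ltr_pdivrMr// ltr_pMr// ltr1n.
have [ltb|geb] := ltP b' Om.
  apply: (mono n2) => //; first by rewrite leq_max leq_maxl orbT.
  by apply: Tb; rewrite (lt_trans _ ltb)// lt_max ltrDl ltr01 orbT.
apply: (mono n3) => //; first by rewrite !leq_max leqnn !orbT.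
apply: (le_trans (mE _ O0)); rewrite (eta_barE n3)// leeD2l//.
apply: le_trans (integral_tail_le n3 Om B B0 O0 _) _.
  by move=> nu nu0; apply: loss_div_le => //; rewrite gea geb.
apply: le_trans (lee_wpmul2l _ tn) _; first by rewrite lee_fin.
rewrite -EFinM lee_fin /d mulrA ler_pdivrMr; last by lra.
by rewrite mulrDr mulr1 mulrC lerDl ltW.
Qed.

End eta_bar_truncation.


(** * The risk of an estimator with [n g(n) --> Omega] *)

Section negbin.
Context {R : realType}.
Implicit Types (p nu : R) (n r : nat).

(** The factor by which the binomial coefficient of the pmf differs from [n ^ (r - 1) / (r - 1)!];
    it tends to 1 and does not involve [p]. *)
Definition ffact_ratio r n : R := (n.-1 ^_ r.-1)%:R / n%:R ^+ r.-1.

Lemma ffact_le_expn n m : (n ^_ m <= n ^ m)%N.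
Proof.
elim: m n => [|m IH] n; first by rewrite ffactn0 expn0.
rewrite ffactnS expnS leq_mul2l (leq_trans (IH _)) ?orbT//.
by case: m {IH} => [|m]; rewrite ?expn0// leq_exp2r// leq_pred.
Qed.

Lemma expn_subn_le_ffact n m : ((n.+1 - m) ^ m <= n ^_ m)%N.
Proof.
elim: m n => [|m IH] n; first by rewrite ffactn0 expn0.
rewrite ffactnS expnS; case: n => [|n]; first by rewrite subSS sub0n mul0n.
rewrite /= subSS; apply: leq_mul; last exact: IH.
by rewrite leq_subr.
Qed.

Lemma ffact_ratio_ge0 r n : 0 <= ffact_ratio r n.
Proof. by rewrite divr_ge0 ?exprn_ge0. Qed.

Lemma ffact_ratio_le1 r n : (0 < n)%N -> ffact_ratio r n <= 1.
Proof.
move=> n0; rewrite ler_pdivrMr ?exprn_gt0 ?ltr0n// mul1r -natrX ler_nat.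
apply: (leq_trans (ffact_le_expn _ _)).
by case: r.-1 => [|m]; rewrite ?expn0// leq_exp2r// leq_pred.
Qed.

Lemma ffact_ratio_ge r n : (0 < r)%N -> (r <= n)%N ->
  (1 - r%:R / n%:R) ^+ r.-1 <= ffact_ratio r n.
Proof.
move=> r0 rn; have n0 : (0 < n)%N by exact: leq_trans rn.
have n0' : 0 < n%:R :> R by rewrite ltr0n.
rewrite /ffact_ratio -[X in (X - _) ^+ _](divff (lt0r_neq0 n0')) -mulrBl -natrB//.
rewrite expr_div_n ler_pM2r ?invr_gt0 ?exprn_gt0// -natrX ler_nat.
apply: leq_trans (expn_subn_le_ffact _ _); rewrite prednK//.
by case: r r0 {rn} => // -[|m] _; rewrite ?expn0//= leq_exp2r// leq_sub2l.
Qed.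

Lemma cvg_ffact_ratio r : (0 < r)%N -> ffact_ratio r n @[n --> \oo] --> (1 : R).
Proof.
move=> r0; apply: (@squeeze_cvgr _ _ _ _ (fun n => (1 - r%:R / n%:R) ^+ r.-1)
    (cst 1)).
- near=> n; rewrite ffact_ratio_ge ?ffact_ratio_le1//.
    by near: n; exact: nbhs_infty_gt.
  by near: n; exact: nbhs_infty_ge.
- have h : (1 - r%:R / n%:R : R) @[n --> \oo] --> (1 - r%:R * 0 : R).
    apply: cvgB; first exact: cvg_cst.
    apply: cvgM; first exact: cvg_cst.
    by apply/gtr0_cvgV0; [near=> n; rewrite ltr0n; near: n;
        exact: nbhs_infty_gt|exact: cvgr_idn].
  rewrite mulr0 subr0 in h.
  by have := cvg_comp _ _ h (@exprn_continuous R r.-1 1); rewrite expr1n.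
- exact: cvg_cst.
Unshelve. all: end_near. Qed.

(** At [nu = n p] the right-hand side is [phi nu] with [e^(- nu)] replaced by [(1 - p) ^ (n - r)],
    up to [ffact_ratio]. *)
Lemma negbin_pmfE r p n : (0 < r)%N -> (0 < n)%N -> 0 < p ->
  p^-1 * negbin_pmf r p n =
  ffact_ratio r n * ((n%:R * p) ^+ r.-1 / (r.-1)`!%:R * (1 - p) ^+ (n - r)).
Proof.
move=> r0 n0 p0; rewrite /negbin_pmf /ffact_ratio -bin_ffact natrM.
have f0 := @fact_pos R r.-1; have n0' : 0 < n%:R :> R by rewrite ltr0n.
case: r r0 f0 => // r _ f0 /=; rewrite exprS exprMn; field.
by rewrite !gt_eqF// exprn_gt0.
Qed.

(** Because [(1 - p)^-1 = 1 + p / (1 - p) <= e^(p / (1 - p))]. *)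
Lemma expR_le_onemX p n : 0 < p < 1 -> expR (- (n%:R * p / (1 - p))) <= (1 - p)
    ^+ n.
Proof.
move=> /andP[p0 p1]; have q0 : 0 < 1 - p by rewrite subr_gt0.
rewrite -mulrA -mulrN expRM_natl lerXn2r ?nnegrE ?expR_ge0 ?(ltW q0)//.
rewrite expRN -[leRHS]invrK lef_pV2 ?posrE ?expR_gt0 ?invr_gt0//.
apply: le_trans (expR_ge1Dx _); rewrite [leLHS](_ : _ = 1 + p / (1 - p))//.
by field; rewrite gt_eqF.
Qed.

Lemma onemX_le_expR p n : p <= 1 -> (1 - p) ^+ n <= expR (- (n%:R * p)).
Proof.
move=> p1; rewrite -mulrN expRM_natl lerXn2r ?nnegrE ?expR_ge0 ?subr_ge0//.
exact: expR_ge1Dx.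
Qed.

Lemma negbin_pmf_ge0 r p n : 0 <= p <= 1 -> 0 <= negbin_pmf r p n.
Proof.
by move=> /andP[p0 p1]; rewrite !mulr_ge0 ?exprn_ge0 ?subr_ge0.
Qed.

(** The case [n = 0] is excluded: for [r = 1] the truncated predecessor gives ['C(0, 0) = 1] and the
    value [p]. *)
Lemma negbin_pmf_small r p n : (0 < n)%N -> (n < r)%N -> negbin_pmf r p n = 0.
Proof.
by move=> n0 nr; rewrite /negbin_pmf bin_small ?mul0r//; lia.
Qed.

End negbin.


Section step.
Context {R : realType}.
Variables (r : nat) (L : R -> R) (C s k : R).
Local Notation mu := (@lebesgue_measure R).
Local Notation Rpos := (`]0%R, +oo[%classic : set R).
Local Notation phi := (@gamma_density R r).
Local Notation W := (@gamma_weight R r s k).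
Hypothesis r0 : (0 < r)%N.
Hypothesis L0 : forall x, 0 < x -> 0 <= L x.
Hypothesis mL : measurable_fun Rpos L.
Hypotheses (C0 : 0 <= C) (s0 : 0 <= s) (k0 : 0 <= k) (kr : k < r%:R).
Hypothesis LC : forall x, 0 < x -> L x <= C * (x `^ (- s) + x `^ k).
Variables (g : nat -> R) (Omega : R).
Hypothesis Omega0 : 0 < Omega.
Hypothesis g0 : forall n, (r <= n)%N -> 0 < g n.
Hypothesis glim : n%:R * g n @[n --> \oo] --> Omega.

(** The [n] with [(n - 1) p <= nu < n p]. Rounding up keeps [n] positive. *)
Definition cell (p nu : R) : nat := (Num.truncn (nu / p)).+1.

Lemma cell_itv p nu : 0 < p -> 0 < nu ->
  nu < (cell p nu)%:R * p <= nu + p.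
Proof.
move=> p0 nu0; have /andP[h1 h2] := truncn_itv (ltW (divr_gt0 nu0 p0)).
rewrite -ltr_pdivrMr// h2/= /cell -natr1 mulrDl mul1r lerD2r.
by rewrite -ler_pdivlMr.
Qed.

(** The cells have length [p], so with the factor [p^-1] the integral over the [n]-th cell is the
    [n]-th term of the risk series. *)
Definition step_integrand (p nu : R) : R :=
  p^-1 * negbin_pmf r p (cell p nu) * L (g (cell p nu) / p).

Lemma step_integrand_ge0 p nu : 0 < p < 1 -> 0 <= step_integrand p nu.
Proof.
move=> /andP[p0 p1]; rewrite /step_integrand.
have [nr|rn] := ltnP (cell p nu) r; first by rewrite negbin_pmf_small// mulr0 mul0r.
apply: mulr_ge0; last by apply: L0; rewrite divr_gt0// g0.
by rewrite mulr_ge0 ?invr_ge0 ?(ltW p0)// negbin_pmf_ge0// !ltW.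
Qed.

Definition cell_set (p : R) (i : nat) : set R := `[i%:R * p, i.+1%:R * p[%classic.

Lemma cellE p i nu : 0 < p -> cell_set p i nu -> cell p nu = i.+1.
Proof.
move=> p0; rewrite /cell_set/= in_itv/= => /andP[h1 h2]; congr _.+1.
apply: truncn_def; rewrite ler_pdivlMr// h1/= ltr_pdivrMr//.
Qed.

Lemma bigcup_cell_set p : 0 < p -> \bigcup_i cell_set p i = `[0, +oo[%classic.
Proof.
move=> p0; apply/seteqP; split => [x [i _]|x]; rewrite /cell_set/= !in_itv/= andbT.
  by move=> /andP[+ _]; apply: le_trans; rewrite mulr_ge0// ltW.
move=> x0; exists (Num.truncn (x / p)) => //=; rewrite in_itv/=.
have /andP[h1 h2] := truncn_itv (divr_ge0 x0 (ltW p0)).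
by rewrite -ler_pdivlMr// h1 -ltr_pdivrMr.
Qed.

Lemma measurable_step_integrand p : 0 < p ->
  measurable_fun (`[0%R, +oo[%classic : set R) (step_integrand p).
Proof.
move=> p0; rewrite -(bigcup_cell_set p p0).
apply/measurable_fun_bigcup; first by move=> i; exact: measurable_itv.
move=> i; apply: (eq_measurable_fun (cst (p^-1 * negbin_pmf r p i.+1 * L (g
    i.+1 / p)))) => //.
by move=> x; rewrite inE => xi; rewrite /step_integrand (cellE _ _ _ p0 xi).
Qed.

Lemma risk_le_step p : 0 < p < 1 ->
  (risk L (nonrandomized g0) p <= \int[mu]_(nu in Rpos) (step_integrand p nu)%:E)%E.
Proof.
move=> /andP[p0 p1]; rewrite risk_nonrandomized//.
have ms := measurable_step_integrand p p0.
have mcell i : measurable (cell_set p i) by exact: measurable_itv.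
have sub i : cell_set p i `<=` `[0, +oo[%classic.
  by rewrite -(bigcup_cell_set p p0) => x xi; exists i.
rewrite integral_itv_obnd_cbnd; last first.
  apply/measurable_EFinP; apply: measurable_funS ms => //.
  by move=> x; rewrite /= !in_itv/= !andbT => /ltW.
(* Below [r] nothing is known about [g], so the terms are replaced by 0 to be nonnegative at every
   index. *)
pose f i := if (r <= i)%N then (negbin_pmf r p i * L (g i / p))%:E else 0%E.
have f0 i : (0 <= f i)%E.
  rewrite /f; case: ifPn => // ri; rewrite lee_fin mulr_ge0 ?negbin_pmf_ge0//.
    by rewrite (ltW p0) ltW.
  by rewrite L0// divr_gt0// g0.
have -> : (\sum_(r <= n <oo) (negbin_pmf r p n * L (g n / p))%:E =
    \sum_(r <= n <oo) f n)%E.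
  rewrite eseries_cond [RHS]eseries_cond; apply: eq_eseriesr => n /andP[_ rn].
  by rewrite /f rn.
rewrite -nneseries_addn//.
(* The term [n = i + r] lives on the cell starting at [(n - 1) p], whence [r.-1]. *)
pose E i := cell_set p (i + r.-1).
rewrite (eq_eseriesr (g := fun i => \int[mu]_(nu in E i) (step_integrand p
    nu)%:E)%E); last first.
  move=> i _; rewrite /f leq_addl.
  rewrite (eq_integral (cst (p^-1 * (negbin_pmf r p (i + r) * L (g (i + r)%N /
      p)))%:E)).
    rewrite integral_cst; last exact: measurable_itv.
    rewrite /E /cell_set/= lebesgue_measure_itv/= lte_fin ltr_pM2r// ltr_nat ltnSn.
    rewrite -EFinB -EFinM -natr1; congr EFin; field.
    by rewrite gt_eqF.
  move=> x; rewrite inE => xi; congr EFin.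
  by rewrite /step_integrand (cellE _ _ _ p0 xi) -addnS (prednK r0) -mulrA.
rewrite -ge0_integral_bigcup//.
- apply: ge0_subset_integral => //.
  + by apply: bigcup_measurable => i _; exact: mcell.
  + exact/measurable_EFinP.
  + by move=> x _; rewrite lee_fin step_integrand_ge0// p0.
  + by move=> x [i _ /sub].
- by move=> i; exact: mcell.
- apply/measurable_EFinP; apply: measurable_funS ms => //.
  by move=> x [i _ /sub].
- by move=> x _; rewrite lee_fin step_integrand_ge0// p0.
- move=> i j _ _ [x [xi xj]]; have := cellE _ _ _ p0 xi.
  by rewrite (cellE _ _ _ p0 xj) => -[] /addIn.
Qed.

(** Both [n g(n)] and its inverse converge, since [Omega > 0], and are therefore bounded; the bound
    on the inverses yields [c1]. *)
Lemma scaled_estimate_bounds : exists c1 c2 : R, [/\ 0 < c1, 0 < c2 &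
  forall n, (r <= n)%N -> c1 <= n%:R * g n <= c2].
Proof.
have pos n : (r <= n)%N -> 0 < n%:R * g n.
  by move=> rn; rewrite mulr_gt0 ?g0// ltr0n (leq_trans r0).
have glimV : (n%:R * g n)^-1 @[n --> \oo] --> Omega^-1.
  by apply: cvgV => //; rewrite gt_eqF.
have bd (v : nat -> R) (l : R) : v n @[n --> \oo] --> l ->
    exists2 M, 0 < M & forall n, v n <= M.
  move=> vl; have /pinfty_ex_gt0[M M0 /= vM] := cvg_seq_bounded (cvgP _ vl).
  by exists M => // n; rewrite (le_trans (ler_norm _))// vM.
have [c2 c20 h2] := bd _ _ glim; have [M M0 h1] := bd _ _ glimV.
exists M^-1, c2; split => //; first by rewrite invr_gt0.
move=> n rn; rewrite h2 andbT -[leRHS]invrK lef_pV2 ?posrE ?invr_gt0 ?pos//.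
Qed.

Lemma powR_addr1_le nu : 0 < nu -> (nu + 1) `^ s <= 2 `^ s * (2 * (nu `^ s + nu
    `^ (- k))).
Proof.
move=> nu0; have p1 := powR_ge0 nu s; have p2 := powR_ge0 nu (- k).
have h1 := ge1_powR_sum k s nu k0 s0 nu0.
have [nu1|nu1] := leP nu 1.
  rewrite (@le_trans _ _ (2 `^ s))//.
    by apply: ge0_ler_powR; rewrite ?nnegrE//; lra.
  by rewrite ler_peMr ?powR_ge0//; lra.
rewrite (@le_trans _ _ ((2 * nu) `^ s))//.
  by apply: ge0_ler_powR; rewrite ?nnegrE//; lra.
rewrite powRM ?(ltW nu0)// ler_wpM2l ?powR_ge0//; lra.
Qed.

Lemma step_integrand_dominated : exists2 M, 0 <= M &
  forall p nu, 0 < p < 1 -> 0 < nu -> step_integrand p nu <= M * W nu.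
Proof.
have [c1 [c2 [c10 c20 gc]]] := scaled_estimate_bounds.
(* [M1] compares the pmf with [phi]: [2 ^ (r - 1)] comes from [n p <= 2 nu], and [e^r] from
   [(1 - p) ^ (n - r) <= e^(r p - n p)] with [p < 1] and [n p > nu]. [M2] bounds the loss at
   [g n / p = (n g n) / (n p)], using [nu < n p <= nu + 1]. *)
pose M1 : R := 2 ^+ r.-1 * expR r%:R.
pose M2 := C * (c1 `^ (- s) * (2 `^ s * 2) + c2 `^ k).
have M10 : 0 <= M1 by rewrite mulr_ge0 ?exprn_ge0 ?expR_ge0.
have M20 : 0 <= M2 by rewrite mulr_ge0// addr_ge0 ?mulr_ge0 ?powR_ge0.
exists (M1 * M2) => [|p nu /andP[p0 p1] nu0]; first by rewrite mulr_ge0.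
have /andP[nl nh] := cell_itv _ _ p0 nu0.
rewrite /step_integrand; set n := cell p nu in nl nh *.
have n0 : (0 < n)%N by [].
have q0 : 0 <= nu `^ s + nu `^ (- k) by rewrite addr_ge0 ?powR_ge0.
have [nr|rn] := ltnP n r.
  rewrite negbin_pmf_small// mulr0 mul0r.
  exact: mulr_ge0 (mulr_ge0 M10 M20) (gamma_weight_ge0 r s k nu nu0).
rewrite /gamma_weight [leRHS](_ : _ = (M1 * phi nu) * (M2 * (nu `^ s + nu `^ (-
    k)))); last by ring.
have np0 : 0 < n%:R * p by rewrite mulr_gt0 ?ltr0n.
have x0 : 0 < g n / p by rewrite divr_gt0// g0.
apply: ler_pM; [|exact: L0| |].
- by rewrite mulr_ge0 ?invr_ge0 ?(ltW p0)// negbin_pmf_ge0// !ltW.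
- rewrite negbin_pmfE// /M1 /gamma_density.
  have f0 := @fact_pos R r.-1.
  have e1 : ffact_ratio r n * ((n%:R * p) ^+ r.-1 / (r.-1)`!%:R * (1 - p) ^+ (n
      - r))
      <= (n%:R * p) ^+ r.-1 / (r.-1)`!%:R * (1 - p) ^+ (n - r).
    rewrite ler_piMl ?ffact_ratio_le1// mulr_ge0 ?divr_ge0 ?exprn_ge0 ?(ltW np0)//.
    by rewrite subr_ge0 ltW.
  apply: (le_trans e1).
  have e2 : (n%:R * p) ^+ r.-1 <= 2 ^+ r.-1 * nu ^+ r.-1.
    (* For [r = 1] the exponent is 0. Otherwise [n >= r >= 2], so [nu >= (n - 1) p >= n p / 2]. *)
    rewrite -exprMn; have [r1|r1] := leqP r 1.
      by rewrite (_ : r.-1 = 0)%N ?expr0//; case: (r) r0 r1 => [|[]].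
    have n2 : 2 <= n%:R :> R by rewrite ler_nat (leq_trans r1).
    have np2 : n%:R * p <= 2 * nu by nra.
    have nu2 : 0 <= 2 * nu by rewrite mulr_ge0// ltW.
    by apply: lerXn2r; rewrite ?nnegrE// ltW.
  have e3 : (1 - p) ^+ (n - r) <= expR r%:R * expR (- nu).
    apply: (le_trans (onemX_le_expR _ _ (ltW p1))).
    rewrite -expRD ler_expR natrB// mulrBl.
    have : 0 <= r%:R :> R by [].
    nra.
  rewrite [leRHS](_ : _ = 2 ^+ r.-1 * nu ^+ r.-1 / (r.-1)`!%:R * (expR r%:R *
      expR (- nu))); last first.
    have rE (a b c d e : R) : a * b * (c * d * e) = a * c * e * (b * d) by ring.
    exact: rE.
  apply: ler_pM => //; rewrite ?divr_ge0 ?exprn_ge0 ?(ltW np0) ?subr_ge0 ?(ltW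
      p1)//.
  by rewrite ler_pM2r ?invr_gt0.
- apply: (le_trans (LC _ x0)); rewrite /M2 -mulrA ler_wpM2l//.
  have gE : g n / p = (n%:R * g n) / (n%:R * p).
    by field; rewrite !gt_eqF ?ltr0n.
  have /andP[g1 g2] := gc _ rn; have ng0 : 0 < n%:R * g n by exact: lt_le_trans g1.
  have h1 : (g n / p) `^ (- s) <= c1 `^ (- s) * (2 `^ s * (2 * (nu `^ s + nu `^
      (- k)))).
    rewrite gE powR_div// opprK ler_pM ?powR_ge0//.
      rewrite !powRN lef_pV2 ?posrE ?powR_gt0//.
      by apply: ge0_ler_powR; rewrite ?nnegrE ?(ltW c10) ?(ltW ng0).
    apply: le_trans (powR_addr1_le _ nu0).
    by apply: ge0_ler_powR; rewrite ?nnegrE ?(ltW np0)//; lra.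
  have h2 : (g n / p) `^ k <= c2 `^ k * nu `^ (- k).
    rewrite gE powR_div// ler_pM ?powR_ge0//.
      by apply: ge0_ler_powR; rewrite ?nnegrE ?(ltW ng0) ?(ltW c20).
    rewrite !powRN lef_pV2 ?posrE ?powR_gt0//.
    by apply: ge0_ler_powR; rewrite ?nnegrE ?(ltW nu0) ?(ltW np0)// ltW.
  have h3 : 0 <= c2 `^ k * nu `^ s by rewrite mulr_ge0 ?powR_ge0.
  rewrite mulrDl -!mulrA; move: h1 h2; rewrite mulrDr; lra.
Qed.

Lemma step_integrand_cvg (u : nat -> R) (nu : R) :
  (forall n, 0 < u n < 1) -> u n @[n --> \oo] --> (0 : R) -> 0 < nu ->
  {for Omega / nu, continuous L} ->
  step_integrand (u n) nu @[n --> \oo] --> phi nu * L (Omega / nu).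
Proof.
move=> u01 u0 nu0 cL; pose N n := cell (u n) nu.
have upos n : 0 < u n by have /andP[] := u01 n.
have Nu : (N n)%:R * u n @[n --> \oo] --> nu.
  apply: (@squeeze_cvgr _ _ _ _ (cst nu) (fun n => nu + u n)).
  - near=> n; have /andP[h1 h2] := cell_itv _ _ (upos n) nu0.
    by rewrite h2 andbT ltW.
  - exact: cvg_cst.
  - by rewrite -[X in _ --> X]addr0; apply: cvgD => //; exact: cvg_cst.
have Ny : N n @[n --> \oo] --> \oo.
  apply/cvgnyPge => A; near=> n.
  have /andP[h1 _] := cell_itv _ _ (upos n) nu0.
  rewrite -(ler_nat R); apply: ltW; rewrite -(ltr_pM2r (upos n)).
  apply: le_lt_trans h1.
  have : u n < nu / A.+1%:R.
    by near: n; apply: cvgr_lt u0 _ _; rewrite divr_gt0 ?ltr0Sn.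
  rewrite ltr_pdivlMr ?ltr0Sn// -natr1 mulrDr mulr1 mulrC => /ltW.
  by apply: le_trans; rewrite lerDl ltW.
have c1 : ffact_ratio r (N n) @[n --> \oo] --> (1 : R).
  exact: cvg_comp Ny (cvg_ffact_ratio r r0).
have c2 : ((N n)%:R * u n) ^+ r.-1 @[n --> \oo] --> nu ^+ r.-1.
  exact: cvg_comp Nu (@exprn_continuous R r.-1 nu).
have c3 : (1 - u n) ^+ (N n - r) @[n --> \oo] --> expR (- nu).
  apply: (@squeeze_cvgr _ _ _ _
    (fun n => expR (- ((N n)%:R * u n / (1 - u n))))
    (fun n => expR (- ((N n)%:R * u n - r%:R * u n)))).
  - near=> n; have /andP[v0 v1] := u01 n.
    have rN : (r <= N n)%N by near: n; move/cvgnyPge : Ny; apply.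
    apply/andP; split.
      apply: le_trans (expR_le_onemX _ (N n) (u01 n)) _.
      rewrite -[in leLHS](subnK rN) exprD ler_piMr ?exprn_ge0 ?subr_ge0 ?(ltW v1)//.
      by rewrite exprn_ile1 ?subr_ge0 ?(ltW v1)// lerBlDr lerDl ltW.
    apply: le_trans (onemX_le_expR _ (N n - r) (ltW v1)) _.
    by rewrite ler_expR lerN2 natrB// mulrBl.
  - apply: (@cvg_comp _ _ _ _ expR _ (nbhs (- nu))); last exact: continuous_expR.
    have : (- ((N n)%:R * u n / (1 - u n))) @[n --> \oo] --> - (nu / (1 - 0)).
      apply: cvgN; apply: cvgM => //; apply: cvgV; first by rewrite subr0.
      by apply: cvgB => //; exact: cvg_cst.
    by rewrite subr0 divr1.
  - apply: (@cvg_comp _ _ _ _ expR _ (nbhs (- nu))); last exact: continuous_expR.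
    have : (- ((N n)%:R * u n - r%:R * u n)) @[n --> \oo] --> - (nu - r%:R * 0).
      by apply: cvgN; apply: cvgB => //; apply: cvgM => //; exact: cvg_cst.
    by rewrite mulr0 subr0.
have c4 : L (g (N n) / u n) @[n --> \oo] --> L (Omega / nu).
  apply: (@cvg_comp _ _ _ (fun n => g (N n) / u n) L _ (nbhs (Omega / nu)));
      last exact: cL.
  (* Multiplying and dividing by [N n] exposes two quantities with positive limits, [Omega] and
     [nu]. *)
  have : ((N n)%:R * g (N n)) / ((N n)%:R * u n) @[n --> \oo] --> Omega / nu.
    apply: cvgM; first exact: cvg_comp Ny glim.
    by apply: cvgV => //; rewrite gt_eqF.
  apply: cvg_trans; apply: near_eq_cvg; near=> n.
  by field; rewrite (gt_eqF (upos n)) /N /cell pnatr_eq0.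
have -> : phi nu * L (Omega / nu) =
    1 * (nu ^+ r.-1 / (r.-1)`!%:R * expR (- nu)) * L (Omega / nu).
  by rewrite mul1r /gamma_density (mulrAC _ _ (expR _)).
have -> : (fun n => step_integrand (u n) nu) = (fun n => ffact_ratio r (N n) *
    (((N n)%:R * u n) ^+ r.-1 / (r.-1)`!%:R * (1 - u n) ^+ (N n - r)) *
    L (g (N n) / u n)).
  by apply/funext => n; rewrite /step_integrand -/(N n) negbin_pmfE.
apply: cvgM => //; apply: cvgM => //; apply: cvgM => //.
by apply: cvgM => //; exact: cvg_cst.
Unshelve. all: end_near. Qed.

End step.


Section upper_bound.
Context {R : realType}.
Variables (r : nat) (L : R -> R) (C s k : R).
Local Notation mu := (@lebesgue_measure R).
Local Notation Rpos := (`]0%R, +oo[%classic : set R).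
Local Notation phi := (@gamma_density R r).
Local Notation W := (@gamma_weight R r s k).
Hypothesis r0 : (0 < r)%N.
Hypothesis L0 : forall x, 0 < x -> 0 <= L x.
Hypothesis Ldisc : finite_set [set x : R | 0 < x /\ ~ {for x, continuous L}].
Hypotheses (C0 : 0 <= C) (s0 : 0 <= s) (k0 : 0 <= k) (kr : k < r%:R).
Hypothesis LC : forall x, 0 < x -> L x <= C * (x `^ (- s) + x `^ k).
Variables (g : nat -> R) (Omega : R).
Hypothesis Omega0 : 0 < Omega.
Hypothesis g0 : forall n, (r <= n)%N -> 0 < g n.
Hypothesis glim : n%:R * g n @[n --> \oo] --> Omega.
Let mL := measurable_loss L Ldisc.

(** The exceptional [nu] are the images of the finitely many discontinuities under
    [x |-> Omega / x]. *)
Lemma ae_continuous_loss (P : set R) :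
  (forall nu, 0 < nu -> {for Omega / nu, continuous L} -> P nu) ->
  {ae mu, forall nu, Rpos nu -> P nu}.
Proof.
move=> contP.
pose S := [set x : R | 0 < x /\ ~ {for x, continuous L}].
pose S' := (fun x => Omega / x) @` S.
have fS' : finite_set S' by exact: finite_image.
exists S'; split.
- by apply: countable_measurable => //; exact: finite_set_countable.
- by apply: countable_lebesgue_measure0; exact: finite_set_countable.
- move=> nu /= /not_implyP[]; rewrite in_itv/= andbT => nu0 nP.
  exists (Omega / nu).
    by split; [rewrite divr_gt0|move=> /(contP _ nu0)/nP].
  by rewrite invf_div mulrCA divff ?mulr1// gt_eqF.
Qed.

Lemma cvg_integral_step (u : nat -> R) :
  (forall n, 0 < u n < 1) -> u n @[n --> \oo] --> (0 : R) ->
  (\int[mu]_(nu in Rpos) (step_integrand r L g (u n) nu)%:E @[n --> \oo] -->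
    eta_bar r L Omega)%E.
Proof.
move=> u01 u0.
have [M M0 dom] := @step_integrand_dominated R r L C s k r0 L0 C0 s0 k0 LC g
    Omega Omega0 g0 glim.
have iW := @integrable_gamma_weight R r r0 s k s0 kr.
have mR : measurable Rpos by exact: measurable_itv.
have := @dominated_convergence _ _ R mu Rpos mR
  (fun n nu => (step_integrand r L g (u n) nu)%:E)
  (fun nu => (phi nu * L (Omega / nu))%:E) (fun nu => (M%:E * (EFin \o W) nu)%E).
case=> //.
- move=> n; apply/measurable_EFinP.
  apply: measurable_funS (@measurable_step_integrand R r L g (u n) _) => //.
    by move=> x; rewrite /= !in_itv/= !andbT => /ltW.
  by have /andP[] := u01 n.
- exact: measurable_eta_bar_integrand.
- apply: ae_continuous_loss => nu nu0 cL.
  apply: cvg_EFin; first by near=> n.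
  by apply: step_integrand_cvg => //; exact: cL.
- exact: (@integrableZl _ _ R mu Rpos mR M _ iW).
- apply: aeW => nu n; rewrite /= in_itv/= andbT => nu0.
  by rewrite lee_fin ger0_norm ?dom// step_integrand_ge0.
Unshelve. all: end_near. Qed.

Lemma eta_bar_fin_num : eta_bar r L Omega \is a fin_num.
Proof.
have := @integrable_eta_bar R r L C s k r0 L0 mL C0 s0 k0 kr LC Omega Omega0.
exact: (@integrable_fin_num _ _ R mu Rpos (measurable_itv _) _).
Qed.

Lemma asymptotic_risk_le_eta_bar :
  (asymptotic_risk L (nonrandomized g0) <= eta_bar r L Omega)%E.
Proof.
apply/lee_addgt0Pr => e e0.
suff H : \forall p \near (0 : R)^'+,
    (risk L (nonrandomized g0) p <= eta_bar r L Omega + e%:E)%E.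
  apply: (@le_trans _ _ (ereal_sup (risk L (nonrandomized g0) @`
      [set p | (risk L (nonrandomized g0) p <= eta_bar r L Omega + e%:E)%E]))).
    by apply: ereal_inf_lbound;
        exists [set p | (risk L (nonrandomized g0) p <= eta_bar r L Omega +
            e%:E)%E].
  by apply: ge_ereal_sup => _ [p /= ? <-].
apply: contrapT => nH.
(* Dominated convergence is a statement on sequences, so a failure near 0 is turned into a sequence
   of bad [p]; the bound [1 / (n + 2)] keeps each of them below 1. *)
have ex n : exists p : R, 0 < p < n.+2%:R^-1 /\
    (eta_bar r L Omega + e%:E < risk L (nonrandomized g0) p)%E.
  apply: contrapT => /forallNP np; apply: nH.
  near=> p; rewrite leNgt; apply/negP => h; apply: (np p); split => //.
  apply/andP; split; near: p; [exact: nbhs_right_gt|exact: nbhs_right_lt].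
pose u n := sval (cid (ex n)).
have uP n : 0 < u n < n.+2%:R^-1 /\
    (eta_bar r L Omega + e%:E < risk L (nonrandomized g0) (u n))%E.
  exact: svalP (cid (ex n)).
have u01 n : 0 < u n < 1.
  have [/andP[-> h] _] := uP n; rewrite (lt_trans h)// invf_lt1 ?ltr0Sn// ltr1n//.
have u0 : u n @[n --> \oo] --> (0 : R).
  apply: (@squeeze_cvgr _ _ _ _ (cst 0) (fun n => n.+1%:R^-1)).
  - near=> n; have [/andP[h1 h2] _] := uP n;
      rewrite (ltW h1)/= (ltW (lt_le_trans h2 _))//.
    by rewrite lef_pV2 ?posrE ?ltr0Sn// ler_nat.
  - exact: cvg_cst.
  - exact: cvg_harmonic.
have := cvg_integral_step u u01 u0.
have fin := eta_bar_fin_num; rewrite -(fineK fin) => /fine_cvgP[fin' cv].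
have [n [f1 f2]] : exists n, (\int[mu]_(nu in Rpos) (step_integrand r L g (u n)
    nu)%:E)%E \is a fin_num /\
   fine (\int[mu]_(nu in Rpos) (step_integrand r L g (u n) nu)%:E)%E < fine
       (eta_bar r L Omega) + e.
  by have := filter_ex (filterI fin' (cvgr_lt _ cv _ _)); apply; rewrite ltrDl.
have [_] := uP n; rewrite ltNge => /negP; apply.
apply: le_trans (@risk_le_step R r L r0 L0 mL g g0 (u n) (u01 n)) _.
by rewrite -(fineK f1) -(fineK fin) -EFinD lee_fin ltW.
Unshelve. all: end_near. Qed.

End upper_bound.


(** * The lower bound for an arbitrary estimator *)

Section scaling.
Context {R : realType}.
Local Notation mu := (@lebesgue_measure R).

Let scale (c : R) : measurableTypeR R -> measurableTypeR R := fun x => c * x.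

Let measurable_scale c : measurable_fun setT (scale c).
Proof. exact: mulrl_measurable. Qed.

Lemma lebesgue_measure_scale (c : R) (c0 : 0 < c) (A : set (measurableTypeR R)) :
  measurable A -> mu A = (c%:E * pushforward mu (scale c) A)%E.
Proof.
move=> mA.
have -> : (c%:E * pushforward mu (scale c) A)%E = mscale (PosNum c0)%:num%:nng
    (pushforward mu (scale c)) A by [].
apply: lebesgue_measure_unique => // _ [[a b] _ <-].
rewrite [RHS](_ : _ = c%:E * mu (scale c @^-1` `]a, b]))%E; last by [].
rewrite (_ : scale c @^-1` _ = `]a / c, b / c]%classic); last first.
  apply/seteqP; split => x; rewrite /= !in_itv/= /scale ltr_pdivrMr// ler_pdivlMr//.
    by rewrite mulrC.
  by rewrite mulrC.
rewrite !lebesgue_measure_itv/= !lte_fin ltr_pM2r ?invr_gt0//.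
case: ifPn => _; last by rewrite mule0.
by rewrite -!EFinB -EFinM -mulrBl mulrCA divff ?mulr1// gt_eqF.
Qed.

Lemma ge0_integral_scale (c : R) (f : R -> \bar R) : 0 < c ->
  measurable_fun setT f -> (forall x, (0 <= f x)%E) ->
  (\int[mu]_x f x = c%:E * \int[mu]_x f (c * x)%R)%E.
Proof.
move=> c0 mf f0.
rewrite (@eq_measure_integral _ _ R setT (mscale (PosNum c0)%:num%:nng
    (pushforward mu (scale c)))); last first.
  by move=> A mA _; rewrite /= (lebesgue_measure_scale c c0).
rewrite ge0_integral_mscale//= ge0_integral_pushforward//=.
Qed.

End scaling.


Section lower.
Context {R : realType}.
Local Notation mu := (@lebesgue_measure R).
Local Notation Rpos := (`]0%R, +oo[%classic : set R).

(** The interval (0, n] has mass [F n - F 0 = F n], which tends to 1. *)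
Lemma cumulative_mass_gt0 (F : cumulativeBounded (0 : R) (1 : R)) : F 0 = 0 ->
  lebesgue_stieltjes_measure F Rpos = 1%E.
Proof.
move=> F0; have -> : Rpos = \bigcup_n `]0, n%:R]%classic.
  apply/seteqP; split => [x|x [n _]] /=; rewrite !in_itv/= andbT; last by case/andP.
  move=> x0; exists (Num.truncn x).+1 => //=; rewrite in_itv/= x0.
  exact/ltW/truncnS_gt.
pose I n : set R := `]0, n%:R]%classic.
have h1 : (lebesgue_stieltjes_measure F \o I) n @[n --> \oo] --> 1%E.
  have -> : lebesgue_stieltjes_measure F \o I = (fun n => (F n%:R)%:E).
    apply/funext=> n; rewrite /= /lebesgue_stieltjes_measure.
    rewrite /measure_extension measurable_mu_extE/=; last exact: is_ocitv.
    by rewrite wlength_itv_bnd// F0 subr0.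
  apply/cvg_EFin; first by near=> n.
  exact/(cvg_comp _ _ (@cvgr_idn R))/cumulativey.
have h2 : (lebesgue_stieltjes_measure F \o I) n @[n --> \oo] -->
    lebesgue_stieltjes_measure F (\bigcup_n I n).
  apply: nondecreasing_cvg_mu; rewrite /I//; first exact: bigcup_measurable.
  by move=> *; apply/subsetPset/subset_itv; rewrite leBSide/= ?ler_nat.
exact: cvg_unique h2 h1.
Unshelve. all: end_near. Qed.

Lemma negbin_pmf_ge_gamma (r a : nat) (eps : R) : (0 < r)%N -> 0 < eps ->
  \forall n \near \oo, forall p, itv_inv a (n%:R * p) ->
    (1 - eps) * gamma_density r (n%:R * p) <= p^-1 * negbin_pmf r p n.
Proof.
move=> r0 e0; pose A : R := a.+1%:R.
have cvA (b : R) : b / n%:R @[n --> \oo] --> (0 : R).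
  rewrite -(mulr0 b); apply: cvgM; first exact: cvg_cst.
  by apply/gtr0_cvgV0; [near=> n; rewrite ltr0n; near: n;
      exact: nbhs_infty_gt|exact: cvgr_idn].
(* Here [n p / (1 - p) = n p + n p * p / (1 - p)], and [n p <= A], [p <= A / n], [p < 1/2] bound the
   excess by [2 A ^ 2 / n], uniformly in [p]. *)
have cv : ffact_ratio r n * expR (- (2 * A ^+ 2 / n%:R)) @[n --> \oo] --> (1 : R).
  rewrite -[X in _ --> X]mulr1; apply: cvgM; first exact: cvg_ffact_ratio.
  rewrite -[X in _ --> X]expR0 -[X in expR X]oppr0.
  apply: (@cvg_comp _ _ _ (fun n => - (2 * A ^+ 2 / n%:R)) expR _ (nbhs (-
      (0:R)))); last exact: continuous_expR.
  by apply: cvgN.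
near=> n => p pI.
have n0 : (0 < n)%N by near: n; exact: nbhs_infty_gt.
have n0' : 0 < n%:R :> R by rewrite ltr0n.
have rn : (r <= n)%N by near: n; exact: nbhs_infty_ge.
have An : A / n%:R < 2^-1 by near: n; apply: cvgr_lt (cvA A) _ _; rewrite invr_gt0.
have ce : 1 - eps < ffact_ratio r n * expR (- (2 * A ^+ 2 / n%:R)).
  by near: n; apply: cvgr_gt cv _ _; rewrite ltrBlDr ltrDl.
have np0 := itv_inv_gt0 _ _ pI.
have p0 : 0 < p by rewrite -(pmulr_rgt0 _ n0').
have npA : n%:R * p <= A by move: pI; rewrite /itv_inv/= in_itv/= => /andP[].
have p2 : p < 2^-1 by apply: le_lt_trans An; rewrite ler_pdivlMr// mulrC.
have f0 := @fact_pos R r.-1.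
rewrite negbin_pmfE// /gamma_density.
apply: (@le_trans _ _ (ffact_ratio r n * expR (- (2 * A ^+ 2 / n%:R)) *
   ((n%:R * p) ^+ r.-1 * expR (- (n%:R * p)) / (r.-1)`!%:R))).
  apply: ler_wpM2r; last exact: ltW.
  by rewrite divr_ge0 ?mulr_ge0 ?exprn_ge0 ?expR_ge0// ltW.
rewrite -mulrA ler_wpM2l ?ffact_ratio_ge0//.
rewrite [leLHS](_ : _ = (n%:R * p) ^+ r.-1 / (r.-1)`!%:R *
  (expR (- (2 * A ^+ 2 / n%:R)) * expR (- (n%:R * p)))); last by ring.
rewrite ler_wpM2l ?divr_ge0 ?exprn_ge0 ?(ltW np0)// -expRD.
have p1 : 0 < p < 1 by rewrite p0 (lt_trans p2)// invf_lt1// ltr1n.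
apply: (@le_trans _ _ ((1 - p) ^+ n)); last first.
  rewrite -[in leLHS](subnK rn) exprD ler_piMr ?exprn_ge0 ?exprn_ile1//; lra.
apply: le_trans (expR_le_onemX p n p1).
rewrite ler_expR -opprD lerN2.
have q0 : 0 < 1 - p by lra.
rewrite ler_pdivrMr//.
have -> : 2 * A ^+ 2 / n%:R = 2 * A * (A / n%:R) by rewrite expr2; ring.
have pA : p <= A / n%:R by rewrite ler_pdivlMr// mulrC.
have h : n%:R * p * p <= A * (A / n%:R) by apply: ler_pM => //; exact: ltW.
have h2 : 0 <= n%:R * p * p by rewrite mulr_ge0// ltW.
nra.
Unshelve. all: end_near. Qed.

End lower.


(** * The kernel to which Tonelli's theorem is applied *)

Section kernel.
Context {R : realType}.
Variables (r : nat) (L : R -> R) (a : nat).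
Local Notation mu := (@lebesgue_measure R).
Local Notation Rpos := (`]0%R, +oo[%classic : set R).
Local Notation phi := (@gamma_density R r).
Hypothesis r0 : (0 < r)%N.
Hypothesis L0 : forall x, 0 < x -> 0 <= L x.
Hypothesis mL : measurable_fun Rpos L.

(** [L] is arbitrary off (0, +oo); its extension by 0 is nonnegative and measurable on the whole
    line, as integration over the product requires. *)
Let Lx := L \_ Rpos.

(* [`^ (-1)] is the inverse on (0, +oo), where the indicator lives, and is
   known to be measurable on the whole line. *)
Definition risk_kernel (n : nat) (z : measurableTypeR R * measurableTypeR R) : R :=
  \1_(itv_inv a) (n%:R * z.1) * (z.1 `^ (-1) * negbin_pmf r z.1 n) *
  Lx (z.2 * z.1 `^ (-1)).

Lemma measurable_risk_kernel n : measurable_fun setT (risk_kernel n).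
Proof.
have mLx : measurable_fun setT Lx.
  exact: (measurable_restrictT L (measurable_itv `]0%R, +oo[)).1 mL.
have m1 : measurable_fun setT (fun z : measurableTypeR R * measurableTypeR R =>
    z.1).
  exact: measurable_fst.
have mi : measurable_fun setT (fun z : measurableTypeR R * measurableTypeR R =>
    z.1 `^ (-1)).
  exact: measurableT_comp (measurable_powR _) m1.
apply: measurable_funM; first apply: measurable_funM.
- have mI : measurable_fun setT (\1_(itv_inv a) : R -> R).
    by apply: measurable_indic; exact: measurable_itv.
  by apply: measurableT_comp mI _; exact: measurable_funM.
- apply: measurable_funM => //; rewrite /negbin_pmf.
  apply: measurable_funM.
    by apply: measurable_funM => //; exact: measurable_funX.
  by apply: measurable_funX; exact: measurable_funB.
- by apply: measurableT_comp mLx _; apply: measurable_funM => //;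
    exact: measurable_snd.
Qed.

Lemma loss_restrict_ge0 x : 0 <= Lx x.
Proof.
by rewrite /Lx patchE; case: ifPn => // /set_mem; rewrite /= in_itv/= andbT => /L0.
Qed.

Lemma loss_restrictE x : 0 < x -> Lx x = L x.
Proof. by move=> x0; rewrite /Lx patchE mem_set//= in_itv/= x0. Qed.

Lemma itv_inv_scale n (p : R) : (a.+1 < n)%N -> itv_inv a (n%:R * p) ->
  [/\ 0 < p, p < 1, p <= a.+1%:R / n%:R & (a.+1%:R * n%:R)^-1 <= p].
Proof.
move=> an pI; have np0 := itv_inv_gt0 _ _ pI.
have n0 : 0 < n%:R :> R by rewrite ltr0n (leq_ltn_trans _ an).
have p0 : 0 < p by rewrite -(pmulr_rgt0 _ n0).
move: pI; rewrite /itv_inv/= in_itv/= => /andP[h1 h2].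
have pA : p <= a.+1%:R / n%:R by rewrite ler_pdivlMr// mulrC.
split => //; first by rewrite (le_lt_trans pA)// ltr_pdivrMr// mul1r ltr_nat.
by rewrite invfM ler_pdivrMr// mulrC.
Qed.

Lemma risk_kernel_ge0 n z : (a.+1 < n)%N -> 0 <= risk_kernel n z.
Proof.
move=> an; rewrite /risk_kernel indicE.
have [/set_mem/(itv_inv_scale _ _ an)[p0 p1 _ _]|_] := boolP (_ \in _);
    last by rewrite !mul0r.
rewrite mul1r mulr_ge0 ?loss_restrict_ge0// mulr_ge0 ?powR_ge0// negbin_pmf_ge0//.
by rewrite !ltW.
Qed.

Lemma integral_risk_kernelE (e : estimator R r) n p : (a.+1 < n)%N ->
  (\int[lebesgue_stieltjes_measure (cond_df e n)]_y (risk_kernel n (p, y))%:E =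
   (\1_(itv_inv a) (n%:R * p) * p^-1)%:E * ((negbin_pmf r p n)%:E *
     \int[lebesgue_stieltjes_measure (cond_df e n)]_(y in Rpos) (L (y / p))%:E))%E.
Proof.
move=> an; have [pI|pI] := boolP ((n%:R * p) \in (itv_inv a : set R)); last first.
  rewrite indicE (negbTE pI) mul0r mul0e integral0_eq// => y _.
  by rewrite /risk_kernel indicE/= (negbTE pI) !mul0r.
have [p0 p1 _ _] := itv_inv_scale _ _ an (set_mem pI).
have pmf0 : 0 <= negbin_pmf r p n by rewrite negbin_pmf_ge0// !ltW.
have mLp : measurable_fun Rpos (fun y => L (y / p)).
  apply: (@measurable_comp _ _ _ _ _ _ Rpos L) => //.
    move=> _ [y /= + <-]; rewrite !in_itv/= !andbT => y0; exact: divr_gt0.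
  exact: measurable_funM.
rewrite muleA -EFinM indicE pI mul1r -ge0_integralZl//; last 3 first.
- exact/measurable_EFinP.
- move=> y; rewrite /= in_itv/= andbT => y0; rewrite lee_fin L0// divr_gt0//.
- by rewrite lee_fin mulr_ge0 ?invr_ge0// ltW.
rewrite [RHS]integral_mkcond; apply: eq_integral => y _.
rewrite patchE /risk_kernel/= indicE pI mul1r powR_inv1 ?(ltW p0)//.
rewrite /Lx patchE; have -> : (y / p \in Rpos) = (y \in Rpos).
  by apply/idP/idP => /set_mem; rewrite /= in_itv/= andbT => h; apply/mem_set;
    rewrite /= in_itv/= andbT; move: h; rewrite pmulr_lgt0// invr_gt0.
by case: ifPn => _; rewrite ?mulr0.
Qed.

Variables (m eps : R).
Hypothesis eps01 : 0 < eps < 1.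
Hypothesis mT : forall Om, 0 < Om -> (m%:E <= eta_bar_trunc r L a Om + eps%:E)%E.

(** The hypothesis [mT] is applied at [Om = n y]; its uniformity is why the bound is free of [y] and
    survives integration against any law of the estimator. *)
Lemma integral_risk_kernel_ge n y : (a.+1 < n)%N -> 0 < y ->
  (forall p, itv_inv a (n%:R * p) ->
    (1 - eps) * phi (n%:R * p) <= p^-1 * negbin_pmf r p n) ->
  (((1 - eps) * (m - eps) / n%:R)%:E <= \int[mu]_p (risk_kernel n (p, y))%:E)%E.
Proof.
move=> an y0 pmf_ge; have /andP[e0 e1] := eps01.
have n0 : 0 < n%:R :> R by rewrite ltr0n (leq_ltn_trans _ an).
pose H := (fun nu => (phi nu * L (n%:R * y / nu))%:E) \_ (itv_inv a : set R).
have sub : (itv_inv a : set R) `<=` Rpos.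
  by move=> x /itv_inv_gt0; rewrite /= in_itv/= andbT.
have ny0 : 0 < n%:R * y by rewrite mulr_gt0.
have mH : measurable_fun setT H.
  apply: (measurable_restrictT _ (measurable_itv `[a.+1%:R^-1, a.+1%:R])).1.
  exact: (measurable_funS (measurable_itv _) sub (measurable_eta_bar_integrand
      r L mL _ ny0)).
have H0 x : (0 <= H x)%E.
  rewrite /H patchE; case: ifPn => // /set_mem/itv_inv_gt0 x0.
  exact: eta_bar_integrand_ge0.
have mHn : measurable_fun (setT : set R) (fun p : R => H (n%:R * p)).
  by apply: (measurableT_comp mH); exact: mulrl_measurable.
have HT : (eta_bar_trunc r L a (n%:R * y) = n%:R%:E * \int[mu]_p H (n%:R * p)%R)%E.
  rewrite -ge0_integral_scale// /eta_bar_trunc integral_mkcond//.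
have le1 : ((1 - eps)%:E * \int[mu]_p H (n%:R * p)%R <= \int[mu]_p (risk_kernel
    n (p, y))%:E)%E.
  rewrite -ge0_integralZl//; last first.
    by rewrite lee_fin subr_ge0 ltW.
  apply: ge0_le_integral => //.
  - by move=> x _; rewrite mule_ge0// lee_fin subr_ge0 ltW.
  - exact: measurable_funeM.
  - apply/measurable_EFinP.
    apply: (measurableT_comp (measurable_risk_kernel n)).
    exact: pair2_measurable.
  - move=> p _; rewrite /H patchE /risk_kernel/= indicE.
    have [pI|pI] := boolP (_ \in _); last by rewrite mule0 !mul0r.
    have [p0 p1 _ _] := itv_inv_scale _ _ an (set_mem pI).
    rewrite mul1r powR_inv1 ?(ltW p0)// loss_restrictE ?divr_gt0//.
    rewrite -EFinM lee_fin mulrA (_ : n%:R * y / (n%:R * p) = y / p); last first.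
      by field; rewrite !gt_eqF.
    by rewrite ler_wpM2r ?L0 ?divr_gt0// pmf_ge//; exact: set_mem.
apply: le_trans le1.
have := mT _ ny0; rewrite HT.
have : (0 <= \int[mu]_p H (n%:R * p)%R)%E by exact: integral_ge0.
case: (integral _ _ _) => [x|_ _|]//.
  rewrite lee_fin -EFinM -EFinD lee_fin => x0 h; rewrite -EFinM lee_fin.
  rewrite ler_pdivrMr// -mulrA ler_wpM2l ?subr_ge0 ?(ltW e1)//; lra.
by rewrite gt0_muley ?leey// lte_fin subr_gt0.
Qed.

End kernel.


(** * Comparison of logarithmic growth rates *)

Section logs.
Context {R : realType}.
Local Notation mu := (@lebesgue_measure R).

Lemma integral_inv (al be : R) : 0 < al -> al < be ->
  (\int[mu]_(x in `[al, be]) (x^-1)%:E = (ln be - ln al)%:E)%E.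
Proof.
move=> al0 albe.
have pos (x : R) : al <= x -> 0 < x by exact: lt_le_trans.
have dln (x : R) : 0 < x -> is_derive x 1 (@ln R) x^-1 by exact: is_derive1_ln.
have cln (x : R) : 0 < x -> {for x, continuous (@ln R)} by exact: continuous_ln.
rewrite (@continuous_FTC2 _ _ (@ln R)) ?EFinB//.
- apply: continuous_in_subspaceT => x; rewrite inE/= in_itv/= => /andP[/pos x0 _].
  by apply: cvgV => //; rewrite gt_eqF.
- split.
  + by move=> x; rewrite in_itv/= => /andP[/ltW/pos/dln[]].
  + by apply: cvg_at_right_filter; exact: cln.
  + by apply: cvg_at_left_filter; apply: cln; exact: lt_trans albe.
- move=> x; rewrite in_itv/= => /andP[/ltW/pos/dln d _].
  by rewrite derive1E derive_val.
Qed.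

(** Telescoping, with [ln (1 + 1 / n) <= 1 / n]. *)
Lemma ln_le_harmonic (n1 n2 : nat) : (0 < n1)%N -> (n1 <= n2)%N ->
  ln n2%:R - ln n1%:R <= \sum_(n1 <= n < n2) n%:R^-1 :> R.
Proof.
move=> n10 n12; rewrite -(telescope_sumr (fun n => ln n%:R : R) n12).
rewrite [leLHS]big_nat_cond [leRHS]big_nat_cond; apply: ler_sum => n.
rewrite andbT => /andP[n1n _].
have n0 : 0 < n%:R :> R by rewrite ltr0n (leq_trans n10).
rewrite -ln_div ?posrE ?ltr0Sn// (_ : n.+1%:R / n%:R = 1 + n%:R^-1); last first.
  by rewrite -natr1; field; rewrite gt_eqF.
by rewrite le_ln1Dx// (lt_trans _ (_ : 0 < _)) ?invr_gt0// ltrN10.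
Qed.

End logs.

Section lower_bound.
Context {R : realType}.
Variables (r : nat) (L : R -> R).
Local Notation mu := (@lebesgue_measure R).
Local Notation Rpos := (`]0%R, +oo[%classic : set R).
Hypothesis r0 : (0 < r)%N.
Hypothesis L0 : forall x, 0 < x -> 0 <= L x.
Hypothesis mL : measurable_fun Rpos L.
Variable e : estimator R r.
Local Notation nu n := (lebesgue_stieltjes_measure (cond_df e n)).
Local Notation loss n p := (\int[nu n]_(y in Rpos) (L (y / p))%:E)%E.

Lemma cond_loss_ge0 n p : 0 < p -> (0 <= loss n p)%E.
Proof.
move=> p0; apply: integral_ge0 => y /=; rewrite in_itv/= andbT => y0.
by rewrite lee_fin L0// divr_gt0.
Qed.

Lemma risk_ge0 p : 0 < p < 1 -> (0 <= risk L e p)%E.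
Proof.
move=> /andP[p0 p1]; apply: nneseries_ge0 => n _ _.
by rewrite mule_ge0 ?cond_loss_ge0// lee_fin negbin_pmf_ge0// !ltW.
Qed.

Lemma risk_ge_partial p (n1 n2 : nat) : 0 < p < 1 -> (r <= n1)%N ->
  (\sum_(n1 <= n < n2) (negbin_pmf r p n)%:E * loss n p <= risk L e p)%E.
Proof.
move=> /andP[p0 p1] rn1.
have t0 n : (0 <= (negbin_pmf r p n)%:E * loss n p)%E.
  by rewrite mule_ge0 ?cond_loss_ge0// lee_fin negbin_pmf_ge0// !ltW.
have [n12|n21] := leqP n1 n2; last first.
  by rewrite big_geq ?(ltnW n21)// risk_ge0// p0.
apply: (@le_trans _ _ (\sum_(r <= n < n2) (negbin_pmf r p n)%:E * loss n p)%E).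
  by rewrite (big_cat_nat rn1 n12)/= leeDr// sume_ge0.
by apply: nneseries_lim_ge => n _ _.
Qed.

Variables (a n1 : nat) (p0 c c' : R).
Hypotheses (p01 : p0 < 1) (c0 : 0 <= c) (c'0 : 0 <= c').
Hypothesis rn1 : (r <= n1)%N.
Hypothesis an1 : (a.+1 < n1)%N.
Hypothesis An1 : a.+1%:R / n1%:R < p0.
Hypothesis risk_c : forall p, 0 < p < p0 -> (risk L e p <= c%:E)%E.
Hypothesis kernel_c' : forall n y, (n1 <= n)%N -> 0 < y ->
  ((c' / n%:R)%:E <= \int[mu]_p (risk_kernel r L a n (p, y))%:E)%E.

(** The double integrals of the kernels are summed over [n] in both orders. Integrating in [p] first
    gives at least [c' / n] for each [n]; integrating in [y] first leaves a sum over [n] bounded by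
    the risk over [p], hence by [c / p]. Letting [n2] grow compares the coefficients of [ln n2]. *)
Lemma log_average_le n2 : (n1 < n2)%N ->
  c' * (ln n2%:R - ln n1%:R) <= c * (ln p0 + ln a.+1%:R + ln n2%:R).
Proof.
move=> n12.
have n1gt0 : (0 < n1)%N by exact: leq_trans rn1.
(* The left end of the range of [p] reached by the kernels with [n < n2], by [itv_inv_scale]. *)
pose al : R := (a.+1%:R * n2%:R)^-1.
have An2 : 0 < a.+1%:R * n2%:R :> R by rewrite mulr_gt0 ?ltr0n ?(leq_ltn_trans
    _ n12).
have al0 : 0 < al by rewrite invr_gt0.
have alp0 : al < p0.
  apply: le_lt_trans An1; rewrite /al invfM.
  apply: ler_pM; rewrite ?invr_ge0//.
    by rewrite (@le_trans _ _ 1)// ?ler1n// invf_le1 ?ltr0Sn// ler1n.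
  by rewrite lef_pV2 ?posrE ?ltr0n// ?ler_nat ?(ltnW n12)// (leq_ltn_trans _ n12).
have mK n : measurable_fun setT (fun z => (risk_kernel r L a n z)%:E).
  by apply/measurable_EFinP; exact: measurable_risk_kernel.
have lower : ((c' * (ln n2%:R - ln n1%:R))%:E <=
    \sum_(n1 <= n < n2) \int[mu]_p \int[nu n]_y (risk_kernel r L a n (p, y))%:E)%E.
  apply: (@le_trans _ _ (\sum_(n1 <= n < n2) (c' / n%:R)%:E)%E).
    rewrite sumEFin lee_fin -mulr_sumr ler_wpM2l//.
    exact: ln_le_harmonic (ltnW n12).
  rewrite big_nat_cond [leRHS]big_nat_cond; apply: lee_sum => n.
  rewrite andbT => /andP[n1n _].
  have an : (a.+1 < n)%N by exact: leq_trans n1n.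
  have K0 z : (0 <= (risk_kernel r L a n z)%:E)%E.
    by rewrite lee_fin risk_kernel_ge0.
  rewrite (fubini_tonelli (fun z => (risk_kernel r L a n z)%:E))//.
  have nuR : nu n Rpos = 1%E.
    by apply: cumulative_mass_gt0; apply: cond_df_pos; exact: leq_trans n1n.
  apply: (@le_trans _ _ (\int[nu n]_(y in Rpos) (c' / n%:R)%:E)%E).
    by rewrite integral_cst//= nuR mule1.
  have mG : measurable_fun setT (fun y => \int[mu]_p (risk_kernel r L a n (p,
      y))%:E)%E.
    exact: (measurable_fun_fubini_tonelli_G _ (mK n) K0).
  apply: (@le_trans _ _ (\int[nu n]_(y in Rpos) \int[mu]_p (risk_kernel r L a n
      (p, y))%:E)%E).
    apply: ge0_le_integral => //.
    - by move=> y _; rewrite lee_fin divr_ge0.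
    - exact: measurable_funTS.
    - by move=> y; rewrite /= in_itv/= andbT; exact: kernel_c'.
  apply: ge0_subset_integral => //.
  by move=> y _; exact: integral_ge0.
have upper : (\sum_(n1 <= n < n2) \int[mu]_p \int[nu n]_y (risk_kernel r L a n
    (p, y))%:E
    <= (c * (ln p0 - ln al))%:E)%E.
  have IK n p : (n1 <= n)%N ->
      (\int[nu n]_y (risk_kernel r L a n (p, y))%:E =
       (\1_(itv_inv a) (n%:R * p) * p^-1)%:E * ((negbin_pmf r p n)%:E * loss n
           p))%E.
    by move=> n1n; apply: integral_risk_kernelE => //; exact: leq_trans n1n.
  have an n : (a.+1 < n + n1)%N by exact: leq_trans an1 (leq_addl _ _).
  have K0 n z : (0 <= (risk_kernel r L a (n + n1) z)%:E)%E.
    by rewrite lee_fin risk_kernel_ge0.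
  have mI n : measurable_fun setT (fun p => \int[nu (n + n1)]_y (risk_kernel r
      L a (n + n1) (p, y))%:E)%E.
    exact: (measurable_fun_fubini_tonelli_F _ (mK _) (K0 n)).
  (* After the shift by [n1] every kernel of the family is nonnegative, which is known only for
     indices above [a.+1]. *)
  rewrite -{1}[n1]add0n big_addn -ge0_integral_sum//; last first.
    by move=> n p _; exact: integral_ge0.
  have inv0 p : `[al, p0]%classic p -> 0 < p.
    by rewrite /= in_itv/= => /andP[+ _]; exact: lt_le_trans.
  have minv : measurable_fun (`[al, p0]%classic : set R) (fun p : R => (p^-1)%:E).
    apply/measurable_EFinP.
    apply: (@eq_measurable_fun _ _ _ _ _ (fun p : R => p `^ (-1))).
      by move=> p /set_mem/inv0 p1; rewrite powR_inv1// ltW.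
    by apply: measurable_funTS; exact: measurable_powR.
  have <- : (\int[mu]_p ((fun p => c%:E * (p^-1)%:E) \_ `[al, p0]) p = (c * (ln
      p0 - ln al))%:E)%E.
    rewrite -integral_mkcond EFinM -integral_inv// -ge0_integralZl//.
    by move=> p /inv0 p1; rewrite lee_fin invr_ge0 ltW.
  have B0 p : (0 <= ((fun p => c%:E * (p^-1)%:E) \_ `[al, p0]) p)%E.
    by apply: erestrict_ge0 => x /inv0 x0;
        rewrite mule_ge0// lee_fin ?invr_ge0// ltW.
  apply: ge0_le_integral => //.
  - by move=> p _; apply: sume_ge0 => n _; exact: integral_ge0.
  - exact: emeasurable_sum.
  - apply: (measurable_restrictT _ (measurable_itv `[al, p0])).1.
    exact: measurable_funeM.
  - move=> p _; rewrite -(big_addn 0 n2 n1 xpredT (fun n => \int[nu n]_y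
      (risk_kernel r L a n (p, y))%:E)%E) add0n.
    (* Outside this range all the indicators vanish; inside it the risk bound [c] is available. *)
    have loc n : (n1 <= n < n2)%N -> itv_inv a (n%:R * p) -> al <= p < p0.
      move=> /andP[n1n nn2] pI;
          have [p_gt0 p1 pA Ap] := itv_inv_scale _ _ _ (leq_trans an1 n1n) pI.
      apply/andP; split.
        apply: le_trans Ap; rewrite /al lef_pV2 ?posrE// ?mulr_gt0 ?ltr0n//.
          by rewrite ler_wpM2l// ler_nat ltnW.
        exact: leq_trans n1n.
      apply: le_lt_trans An1; apply: le_trans pA _.
      by rewrite ler_wpM2l// lef_pV2 ?posrE ?ltr0n// ?ler_nat// (leq_trans n1gt0).
    have [/andP[alp pp0]|out] := boolP (al <= p < p0); last first.
      rewrite big_nat_cond big1// => n; rewrite andbT => nn.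
      rewrite IK; last by case/andP: nn.
      rewrite indicE memNset ?mul0r ?mul0e// => /(loc _ nn) h.
      by rewrite h in out.
    have p_gt0 : 0 < p by exact: lt_le_trans alp.
    have p_lt1 : p < 1 by exact: lt_trans p01.
    have t0 n : (0 <= (negbin_pmf r p n)%:E * loss n p)%E.
      by rewrite mule_ge0 ?cond_loss_ge0// lee_fin negbin_pmf_ge0// !ltW.
    rewrite patchE mem_set; last by rewrite /= in_itv/= alp ltW.
    apply: (@le_trans _ _ ((p^-1)%:E * \sum_(n1 <= n < n2) (negbin_pmf r p
        n)%:E * loss n p)%E).
      rewrite ge0_sume_distrr// big_nat_cond [leRHS]big_nat_cond;
          apply: lee_sum => n.
      rewrite andbT => /andP[n1n _]; rewrite IK//.
      apply: lee_wpmul2r; first exact: t0.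
      rewrite lee_fin ler_piMl ?invr_ge0 ?(ltW p_gt0)//.
    rewrite [leRHS]muleC; apply: lee_wpmul2l; first by rewrite lee_fin invr_ge0 ltW.
    apply: (le_trans (risk_ge_partial p n1 n2 _ rn1)); first by rewrite p_gt0.
    by apply: risk_c; rewrite p_gt0.
have := le_trans lower upper; rewrite lee_fin /al lnV ?posrE// lnM ?posrE ?ltr0n//.
  by rewrite opprK addrA.
by rewrite (leq_ltn_trans _ n12).
Qed.

End lower_bound.


Lemma eta_le_asymptotic_risk (R : realType) (r : nat) (L : R -> R) (m : R)
    (e : estimator R r) : (0 < r)%N -> (forall x, 0 < x -> 0 <= L x) ->
  measurable_fun (`]0%R, +oo[%classic : set R) L ->
  (forall eps : R, 0 < eps -> exists a, forall Om, 0 < Om ->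
    (m%:E <= eta_bar_trunc r L a Om + eps%:E)%E) ->
  (m%:E <= asymptotic_risk L e)%E.
Proof.
move=> r0 L0 mL mT; rewrite leNgt; apply/negP.
move=> /ereal_inf_lt[y [V [d /= d0 Vd] <-{y}] Vm].
pose p0 := Num.min d 2^-1.
have p00 : 0 < p0 by rewrite lt_min d0 invr_gt0 ltr0n.
have p01 : p0 < 1 by rewrite gt_min (@invf_lt1 _ 2)// ltr1n orbT.
have risk_le p : 0 < p < p0 -> (risk L e p <= ereal_sup (risk L e @` V))%E.
  move=> /andP[p_gt0 pp0]; apply: ereal_sup_ubound; exists p => //;
      apply: Vd => //=.
  by rewrite sub0r normrN gtr0_norm// (lt_le_trans pp0)// ge_min lexx.
have sup0 : (0 <= ereal_sup (risk L e @` V))%E.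
  have p2 : 0 < p0 / 2 < p0 by lra.
  apply: le_trans (risk_le _ p2); apply: risk_ge0 => //; lra.
have [c cE] : exists c : R, ereal_sup (risk L e @` V) = c%:E.
  by move: sup0 Vm; case: (ereal_sup _) => // c _ _; exists c.
rewrite cE in Vm sup0 risk_le; rewrite lte_fin in Vm; rewrite lee_fin in sup0.
(* Chosen so that [(1 - eps) (m - eps) = m - eps (1 + m) + eps ^ 2 > m - (m - c) / 2 > c]. *)
pose eps := (m - c) / (2 * (1 + m)).
have epsE : eps * (2 * (1 + m)) = m - c by rewrite divfK// gt_eqF//; lra.
have eps0 : 0 < eps by rewrite divr_gt0//; lra.
have eps1 : eps < 1 by nra.
pose c' := (1 - eps) * (m - eps).
have cc' : c < c' by rewrite /c'; nra.
have [a Ta] := mT _ eps0.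
have [N _ HN] := negbin_pmf_ge_gamma r a eps r0 eps0.
(* Past [n1] the comparison of the pmf with [phi] holds, and all [p] with [n p] in [itv_inv a] lie
   below [p0]. *)
pose n1 := maxn N (maxn r (maxn a.+2 (Num.truncn (a.+1%:R / p0)).+1)).
have n1N : (N <= n1)%N by rewrite leq_maxl.
have rn1 : (r <= n1)%N by rewrite leq_max leq_maxl orbT.
have an1 : (a.+1 < n1)%N by rewrite !leq_max leqnn !orbT.
have An1 : a.+1%:R / n1%:R < p0.
  rewrite ltr_pdivrMr ?ltr0n ?(leq_trans r0)// mulrC -ltr_pdivrMr//.
  by apply: (lt_le_trans (truncnS_gt _)); rewrite ler_nat !leq_max leqnn !orbT.
have kern n y : (n1 <= n)%N -> 0 < y ->
    ((c' / n%:R)%:E <= \int[@lebesgue_measure R]_p (risk_kernel r L a n (p,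
        y))%:E)%E.
  move=> n1n y0; apply: integral_risk_kernel_ge => //.
  - by rewrite eps0.
  - exact: leq_trans n1n.
  - by apply: HN; exact: leq_trans n1n.
(* The conclusion of [log_average_le] rearranges to [(c' - c) ln n2 <= B], which [n2] is chosen to
   violate. *)
pose B := c * (ln p0 + ln a.+1%:R) + c' * ln n1%:R.
pose n2 := maxn n1.+1 (Num.truncn (expR (B / (c' - c)))).+1.
have n12 : (n1 < n2)%N by rewrite leq_maxl.
have := @log_average_le R r L r0 L0 mL e a n1 p0 c c' p01 sup0 _ rn1 an1 An1
    risk_le kern n2 n12.
have c'0 : 0 <= c' by lra.
move=> /(_ c'0); rewrite leNgt => /negP; apply.
have : B / (c' - c) < ln n2%:R.
  rewrite -ltr_expR lnK ?posrE ?ltr0n ?(leq_ltn_trans _ n12)//.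
  by apply: (lt_le_trans (truncnS_gt _)); rewrite ler_nat leq_maxr.
rewrite ltr_pdivrMr ?subr_gt0// /B; lra.
Qed.

Theorem corollary1 (R : realType) (r : nat) (hr : (0 < r)%N) (L : R -> R)
  (hL : forall x, 0 < x -> 0 <= L x)
  (h1 : forall x1 x2, 0 < x1 -> x1 < x2 -> bounded_variation x1 x2 L)
  (h2 : finite_set [set x : R | 0 < x /\ ~ {for x, continuous L}])
  (h3 : exists2 K : R, K < r%:R & is_Theta_at0 L (fun x => x `^ K))
  (h3' : exists2 K' : R, K' < r%:R & is_Theta_aty L (fun x => x `^ K'))
  (h4 : exists xi : R, [/\ 0 < xi,
          {in `]0, xi[ &, nonincreasing_fun L} &
          (0 < \int[lebesgue_measure]_(x in `]xi, +oo[)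
                 ((L xi - L x) / x ^+ r.+1)%:E)%E])
  (h5 : exists xi' : R, [/\ 0 < xi',
          {in `]xi', +oo[ &, nondecreasing_fun L} &
          upward_jump L xi' \/ left_increase_order L xi'])
  (Omega : R) (hOmega : 0 < Omega)
  (hmin : forall Omega', 0 < Omega' ->
            (eta_bar r L Omega <= eta_bar r L Omega')%E)
  (g : nat -> R) (hg : forall n, (r <= n)%N -> 0 < g n)
  (hlim : n%:R * g n @[n --> \oo] --> Omega) :
  forall e : estimator R r,
    (asymptotic_risk L (nonrandomized hg) <= asymptotic_risk L e)%E.
Proof.
move=> e.
have [C [s [k [C0 s0 /andP[k0 kr] LC]]]] := loss_growth L r hr h1 h3 h3'.
have mL := measurable_loss L h2.
have fin := eta_bar_fin_num r L C s k hr hL h2 C0 s0 k0 kr LC Omega hOmega.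
have [xi [xi0 Lxi _]] := h4; have [xi' [xi'0 Lxi' _]] := h5.
have mE Om : 0 < Om -> ((fine (eta_bar r L Omega))%:E <= eta_bar r L Om)%E.
  by move=> Om0; rewrite fineK// hmin.
apply: (@le_trans _ _ (eta_bar r L Omega)).
  exact: (asymptotic_risk_le_eta_bar r L C s k).
rewrite -(fineK fin); apply: eta_le_asymptotic_risk => // eps eps0.
exact: (eta_bar_trunc_uniform r L C s k hr hL mL C0 s0 k0 kr LC _ mE xi xi').
Qed.
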